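(* Let $\tau\neq 0$ be a real constant and let $k\geq 0$. Let $\Omega\subset\mathbb{R}^2$ be a bounded domain whose boundary $\Gamma=\partial\Omega$ is a non convex Jordan curve of class $C^k$. Then there exists a $C^k$ function $\varphi:\Gamma\to\mathbb{R}$ that does not admit a minimal extension over $\overline{\Omega}$ in $Nil_3(\tau)$.
   Context: $Nil_3(\tau)$ is $\mathbb{R}^3$ with the metric $dx_1^2+dx_2^2+(\tau(x_2dx_1-x_1dx_2)+dx_3)^2$. The graph $x_3=u(x_1,x_2)$ of a $C^2$ function $u$ on an open set of $\mathbb{R}^2$ is minimal in $Nil_3(\tau)$ if and only if $u$ satisfies the minimal surface equation $$\left(1+(u_2-\tau x_1)^2\right)u_{11}-2(u_1+\tau x_2)(u_2-\tau x_1)u_{12}+\left(1+(u_1+\tau x_2)^2\right)u_{22}=0,$$ where subscripts denote partial derivatives. For a continuous function $\varphi$ on $\partial\Omega$, a minimal extension of $\varphi$ over $\overline\Omega$ is a continuous function $u:\overline\Omega\to\mathbb{R}$, smooth on $\Omega$, satisfying the minimal surface equation on $\Omega$, with $u|_{\partial\Omega}=\varphi$. The boundary is of class $C^k$ in the sense that every $p\in\partial\Omega$ is the center of an open ball $B\subset\mathbb{R}^2$ such that $B\cap\partial\Omega$ is the graph of a $C^k$ function defined on some open interval (in suitable Euclidean coordinates). A Jordan curve $\Gamma=\partial\Omega$ bounding the bounded open set $\Omega$ is convex if for every $p\in\Gamma$ there is a straight line $l_p$ through $p$ with $\Omega\subset\mathbb{R}^2\setminus l_p$; equivalently, $\overline\Omega$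 is a convex set. It is non convex otherwise. *)

(* Defs.v *)
From HB Require Import structures.
From mathcomp Require Import all_boot all_order all_algebra.
From mathcomp Require Import all_classical all_reals all_analysis.
Set Implicit Arguments.
Unset Strict Implicit.
Unset Printing Implicit Defensive.
Import Order.TTheory GRing.Theory Num.Theory.
Import numFieldNormedType.Exports.
Local Open Scope classical_set_scope.
Local Open Scope ring_scope.

Section Plane.
Context {R : realType}.
Implicit Types (p q d e : R * R) (A G Omega : set (R * R)).

Definition dot p q : R := p.1 * q.1 + p.2 * q.2.

(* The library norm on R * R is the sup norm, hence the explicit disc. *)
Definition disc p (r : R) : set (R * R) :=
  [set q | dot (q - p) (q - p) < r ^+ 2].

Definition line p d : set (R * R) := [set p + t *: d | t in [set: R]].

Definition boundary A : set (R * R) := closure A `\` interior A.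

Definition domain Omega : Prop :=
  [/\ Omega !=set0, open Omega & connected Omega].

Definition jordan_curve G : Prop :=
  exists gamma : R -> R * R,
    [/\ {within `[0, 1], continuous gamma},
        gamma 0 = gamma 1,
        {in `[0, 1[ &, injective gamma} &
        gamma @` `[0, 1] = G].

Definition convex_boundary Omega : Prop :=
  forall p, boundary Omega p ->
    exists2 d, d != 0 & Omega `<=` ~` line p d.

Definition Ck_itv (k : nat) (a b : R) (f : R -> R) : Prop :=
  forall x, x \in `]a, b[ ->
    (forall j, (j < k)%N -> derivable (derive1n j f) x 1) /\
    (forall j, (j <= k)%N -> {for x, continuous (derive1n j f)}).

(* (o; e1, e2) are the origin and the axes of the Euclidean coordinates. *)
Definition graph_point (o e1 e2 : R * R) (f : R -> R) (t : R) : R * R :=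
  o + t *: e1 + f t *: e2.

Definition local_graph G p (o e1 e2 : R * R) (a b : R) (f : R -> R) : Prop :=
  [/\ dot e1 e1 = 1, dot e2 e2 = 1, dot e1 e2 = 0 &
      exists2 r : R, 0 < r &
        disc p r `&` G = graph_point o e1 e2 f @` `]a, b[ ].

Definition Ck_curve (k : nat) G : Prop :=
  forall p, G p -> exists o e1 e2 a b f,
    local_graph G p o e1 e2 a b f /\ Ck_itv k a b f.

(* Only the values of phi on G matter: phi is C^k along G when it is C^k in
   every local parametrization of G as the graph of a C^k function. *)
Definition Ck_on_curve (k : nat) G (phi : R * R -> R) : Prop :=
  forall p, G p -> forall o e1 e2 a b f,
    local_graph G p o e1 e2 a b f -> Ck_itv k a b f ->
    Ck_itv k a b (phi \o graph_point o e1 e2 f).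

Definition d1 (u : R * R -> R) : R * R -> R := 'D_(1, 0) u.
Definition d2 (u : R * R -> R) : R * R -> R := 'D_(0, 1) u.

Fixpoint Ck_on (n : nat) (Omega : set (R * R)) (u : R * R -> R) : Prop :=
  (forall p, Omega p -> {for p, continuous u}) /\
  if n is m.+1 then
    [/\ forall p, Omega p -> derivable u p (1, 0) /\ derivable u p (0, 1),
        Ck_on m Omega (d1 u) & Ck_on m Omega (d2 u)]
  else True.

Definition smooth_on Omega (u : R * R -> R) : Prop :=
  forall n, Ck_on n Omega u.

Definition minimal_surface_eq (tau : R) (u : R * R -> R) p : Prop :=
  (1 + (d2 u p - tau * p.1) ^+ 2) * d1 (d1 u) p
  - 2 * (d1 u p + tau * p.2) * (d2 u p - tau * p.1) * d2 (d1 u) p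
  + (1 + (d1 u p + tau * p.2) ^+ 2) * d2 (d2 u) p = 0.

(* The values of u outside the closure of Omega are irrelevant. *)
Definition minimal_extension (tau : R) Omega (phi u : R * R -> R) : Prop :=
  [/\ {within closure Omega, continuous u},
      smooth_on Omega u,
      forall p, Omega p -> minimal_surface_eq tau u p &
      forall p, boundary Omega p -> u p = phi p].

End Plane.

(* Main.v *)
Require Import Defs.
From mathcomp Require Import all_boot all_order all_algebra.
From mathcomp Require Import all_classical all_reals all_analysis.
From mathcomp Require Import ring lra.
Import Order.TTheory GRing.Theory Num.Theory.
Import numFieldNormedType.Exports.
Local Open Scope classical_set_scope.
Local Open Scope ring_scope.

(* Over the exterior of a disc of centre c and radius rho, the function
   w = - A sqrt(|q - c|^2 - rho^2) + (a linear function) is a strict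
   supersolution of the minimal surface equation as soon as
   A^2 >= 1 + tau^2 rho^2, and its slope is infinite on the rim of the disc.
   Hence, for a solution u, the maximum of u - w is attained neither in Omega
   outside the disc nor in Omega on the rim: it is attained on the rest of the
   boundary.

   A connected open set that is not convex contains two sides [y, x] and [y, z]
   of a triangle but not the third one. A point p of the triangle outside Omega
   that is farthest from a remote centre c beyond [x, z] is a boundary point
   near which the exterior of the disc of centre c through p lies in Omega.

   Take phi with a value N at p and phi <= 0 on the boundary away from a small
   disc around p. The barrier around that disc bounds u off the disc, and then
   barriers around slightly enlarged discs of centre c bound u near p, both
   independently of N. Letting the enlarged discs shrink bounds u p = N, which
   is absurd for N large. *)

(** * Derivatives along lines *)

Section Calculus.
Context {R : realType}.

(** An estimate of the increment itself, without division by h, suits a function whose increment is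
    bounded leg by leg. *)
Lemma is_derive_littleo (V : normedModType R) (f : V -> R) (a v : V) (l : R) :
  (forall e, 0 < e -> exists2 d, 0 < d & forall h, `|h| < d ->
     `|f (a + h *: v) - f a - h * l| <= e * `|h|) ->
  is_derive a v f l.
Proof.
move=> H.
have cv : (fun h => h^-1 *: ((f \o shift a) (h *: v) - f a)) @ (0:R)^' --> (l : R).
  apply/cvgrPdist_le => e e0; have [d d0 Hd] := H e e0.
  rewrite near_withinE; near=> h => h0.
  have hd : `|h| < d.
    near: h; apply/nbhs_ballP; exists d => // z /=.
    by rewrite -ball_normE /= sub0r normrN.
  have hn : 0 < `|h| by rewrite normr_gt0.
  rewrite /= [h *: v + a]addrC -[l](mulKf h0) /GRing.scale /= -mulrBr normrM normfV.
  by rewrite ler_pdivrMl // distrC [_ * e]mulrC; exact: Hd.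
by split; [apply/cvg_ex; exists l|apply: cvg_lim cv].
Unshelve. all: by end_near. Qed.

Lemma is_derive_line (V : normedModType R) (u : V -> R) (q v : V) (t l : R) :
  is_derive (q + t *: v) v u l ->
  is_derive t 1 (fun s => u (q + s *: v)) l.
Proof.
have E : (fun h => h^-1 *: (((fun s => u (q + s *: v)) \o shift t) (h *: (1:R)) -
    u (q + t *: v))) =
   (fun h => h^-1 *: ((u \o shift (q + t *: v)) (h *: v) - u (q + t *: v))).
  apply/funext => h /=; congr (_ *: (u _ - _)).
  by rewrite [h *: 1]mulr1 scalerDl addrCA.
by move=> [du <-]; split; rewrite /derivable /derive E.
Qed.

Lemma is_derive_sub (f g : R -> R) (t a b : R) :
  is_derive t 1 f a -> is_derive t 1 g b ->
  is_derive t 1 (fun s => f s - g s) (a - b).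
Proof. by move=> df dg; exact: is_deriveB. Qed.

(** Both signs of [h] are covered, and the intermediate point is controlled in absolute value only,
    so that legs in either direction are treated alike. *)
Lemma MVT_abs (f df : R -> R) (h : R) :
  (forall t : R, `|t| <= `|h| -> is_derive t 1 f (df t)) ->
  exists2 c, `|c| <= `|h| & f h - f 0 = h * df c.
Proof.
move=> H.
have cf a b : `|a| <= `|h| -> `|b| <= `|h| -> {within `[a, b], continuous f}.
  move=> ah bh; apply: derivable_within_continuous => x.
  rewrite in_itv /= => xab; have [] // := H x.
  rewrite ler_norml; move: ah bh; rewrite !ler_norml; lra.
have [h0|/ltW h0] := leP 0 h.
  have [||c] := @MVT_segment R f df 0 h h0.
  - move=> x; rewrite in_itv /= => xab; apply: H.
    by rewrite (ger0_norm h0) ler_norml; lra.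
  - by apply: cf; rewrite ?normr0.
  rewrite in_itv /= => cab ->; exists c; last by rewrite subr0 mulrC.
  by rewrite (ger0_norm h0) ler_norml; lra.
have [||c] := @MVT_segment R f df h 0 h0.
- move=> x; rewrite in_itv /= => xab; apply: H.
  by rewrite (ler0_norm h0) ler_norml; lra.
- by apply: cf; rewrite ?normr0.
rewrite in_itv /= => cab; exists c; last by lra.
by rewrite (ler0_norm h0) ler_norml; lra.
Qed.

Implicit Types (Omega : set (R * R)) (u : R * R -> R) (p q v : R * R).

Lemma Ck_on_continuous {n Omega u} : Ck_on n Omega u ->
  forall p, Omega p -> {for p, continuous u}.
Proof. by case: n => [|n] []. Qed.

Lemma Ck_on_d1 {n Omega u} : Ck_on n.+1 Omega u -> Ck_on n Omega (d1 u).
Proof. by move=> [_ [_ u1 _]]; exact: u1. Qed.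

Lemma Ck_on_d2 {n Omega u} : Ck_on n.+1 Omega u -> Ck_on n Omega (d2 u).
Proof. by move=> [_ [_ _ u2]]; exact: u2. Qed.

Lemma Ck_on_W {n Omega u} : Ck_on n.+1 Omega u -> Ck_on n Omega u.
Proof.
elim: n u => [|n IHn] u [cu [du u1 u2]]; first by split.
by split; [exact: cu|split; [exact: du|exact: IHn u1|exact: IHn u2]].
Qed.

Lemma is_derive_d1 {Omega} {u} (x y : R) : Ck_on 1 Omega u -> Omega (x, y) ->
  is_derive x 1 (fun s => u (s, y)) (d1 u (x, y)).
Proof.
move=> [_ [du _ _]] /[dup] Oxy /du[+ _] => /derivableP.
have -> : (x, y) = (0, y) + x *: (1, 0) :> R * R.
  by congr pair; rewrite /= ?add0r ?[_ *: _]mulr1 ?[_ *: _]mulr0 ?addr0.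
move=> /is_derive_line; congr (is_derive _ _ _ _); apply/funext => s; congr u.
by congr pair; rewrite /= ?add0r ?[_ *: _]mulr1 ?[_ *: _]mulr0 ?addr0.
Qed.

Lemma is_derive_d2 {Omega} {u} (x y : R) : Ck_on 1 Omega u -> Omega (x, y) ->
  is_derive y 1 (fun s => u (x, s)) (d2 u (x, y)).
Proof.
move=> [_ [du _ _]] /[dup] Oxy /du[_] => /derivableP.
have -> : (x, y) = (x, 0) + y *: (0, 1) :> R * R.
  by congr pair; rewrite /= ?add0r ?[_ *: _]mulr1 ?[_ *: _]mulr0 ?addr0.
move=> /is_derive_line; congr (is_derive _ _ _ _); apply/funext => s; congr u.
by congr pair; rewrite /= ?add0r ?[_ *: _]mulr1 ?[_ *: _]mulr0 ?addr0.
Qed.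

Lemma nbhs_square (A : set (R * R)) p : nbhs p A ->
  exists2 d : R, 0 < d &
    forall x y, `|x - p.1| < d -> `|y - p.2| < d -> A (x, y).
Proof.
move=> /nbhs_ballP[d /= d0 H]; exists d => // x y hx hy; apply: H.
by split; rewrite -ball_normE /= distrC.
Qed.

Lemma continuous_square u p (e : R) : {for p, continuous u} -> 0 < e ->
  exists2 d : R, 0 < d & forall x y, `|x - p.1| < d -> `|y - p.2| < d ->
    `|u (x, y) - u p| <= e.
Proof.
move=> cu e0; have /cvgrPdist_le/(_ e e0)/nbhs_square[d d0 H] := cu.
by exists d => // x y hx hy; rewrite distrC; exact: H.
Qed.

Lemma is_derive_shift0 (f : R -> R) (a t l : R) :
  is_derive (a + t) 1 f l -> is_derive t 1 (fun s => f (a + s)) l.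
Proof.
move=> H.
have : is_derive (a + t *: 1) (1 : R) f l by rewrite [_ *: _]mulr1.
move=> /is_derive_line; congr (is_derive _ _ _ _); apply/funext => s.
by rewrite [_ *: _]mulr1.
Qed.

(* Moving first horizontally and then vertically, the mean value theorem
   controls each leg. *)
Lemma is_derive_C1 {Omega} {u} p v : open Omega -> Ck_on 1 Omega u -> Omega p ->
  is_derive p v u (v.1 * d1 u p + v.2 * d2 u p).
Proof.
case: p => x y; case: v => a b oO Cu Oxy /=.
have := Cu; rewrite /= => -[_ [_ [cd1 _] [cd2 _]]].
apply: is_derive_littleo => e e0.
(* A tolerance [e / m] on each partial derivative, weighted by |a| and |b|, adds up to at most [e];
   the summand 1 keeps [m] positive when the direction is 0. *)
set m := `|a| + `|b| + 1.
have m0 : 0 < m by rewrite /m; have := normr_ge0 a; have := normr_ge0 b; lra.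
have em : 0 < e / m by rewrite divr_gt0.
have [dO dO0 HO] := nbhs_square _ _ (open_nbhs_nbhs (conj oO Oxy)).
have [e1 e10 H1] := continuous_square _ _ _ (cd1 _ Oxy) em.
have [e2 e20 H2] := continuous_square _ _ _ (cd2 _ Oxy) em.
rewrite /= in HO H1 H2.
pose d := Num.min dO (Num.min e1 e2).
have d0 : 0 < d by rewrite !lt_min dO0 e10.
exists (d / m); first by rewrite divr_gt0.
move=> h hd.
have hm : `|h| * m < d by rewrite -ltr_pdivlMr.
have ha : `|h * a| < d.
  rewrite normrM; apply: le_lt_trans hm; apply: ler_wpM2l => //.
  by rewrite /m; have := normr_ge0 b; lra.
have hb : `|h * b| < d.
  rewrite normrM; apply: le_lt_trans hm; apply: ler_wpM2l => //.
  by rewrite /m; have := normr_ge0 a; lra.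
have dd : forall z : R, `|z| < d -> [/\ `|z| < dO, `|z| < e1 & `|z| < e2].
  by move=> z; rewrite !lt_min => /andP[-> /andP[-> ->]].
have add1 (z w : R) : z + w - z = w by ring.
have inO s t : `|s| <= `|h * a| -> `|t| <= `|h * b| -> Omega (x + s, y + t).
  move=> sa tb; apply: HO; rewrite add1.
    by have [] := dd s (le_lt_trans sa ha).
  by have [] := dd t (le_lt_trans tb hb).
have [c1 c1h E1] := @MVT_abs (fun s => u (x + s, y + h * b))
  (fun s => d1 u (x + s, y + h * b)) (h * a) (fun t th =>
  is_derive_shift0 (fun s => u (s, y + h * b)) x t _
    (is_derive_d1 _ _ Cu (inO t _ th (lexx _)))).
have [c2 c2h E2] := @MVT_abs (fun s => u (x, y + s))
  (fun s => d2 u (x, y + s)) (h * b) (fun t th =>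
  is_derive_shift0 (fun s => u (x, s)) y t _
    (is_derive_d2 _ _ Cu
      (eq_ind _ (fun z => Omega (z, y + t)) (inO 0 t ltac:(by rewrite normr0) th) _ (addr0 x)))).
have -> : (x, y) + h *: (a, b) = (x + h * a, y + h * b) :> R * R by [].
have -> : u (x + h * a, y + h * b) - u (x, y) - h * (a * d1 u (x, y) + b * d2 u (x, y))
  = h * (a * (d1 u (x + c1, y + h * b) - d1 u (x, y)) +
         b * (d2 u (x, y + c2) - d2 u (x, y))).
  rewrite !addr0 in E1 E2.
  have -> : u (x + h * a, y + h * b) = u (x, y) + h * a * d1 u (x + c1, y + h * b)
     + h * b * d2 u (x, y + c2) by rewrite -E1 -E2; ring.
  ring.
have {E1}B1 : `|d1 u (x + c1, y + h * b) - d1 u (x, y)| <= e / m.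
  apply: H1; rewrite add1; first by have [] := dd c1 (le_lt_trans c1h ha).
  by have [] := dd _ hb.
have {E2}B2 : `|d2 u (x, y + c2) - d2 u (x, y)| <= e / m.
  apply: H2; rewrite ?add1 ?subrr ?normr0 //.
  by have [] := dd c2 (le_lt_trans c2h hb).
rewrite normrM mulrC; apply: ler_wpM2r => //.
apply: (le_trans (ler_normD _ _)); rewrite !normrM.
apply: (@le_trans _ _ (`|a| * (e / m) + `|b| * (e / m))).
  by apply: lerD; apply: ler_wpM2l.
rewrite -mulrDl mulrCA ger_pMr // ler_pdivrMr // mul1r /m; lra.
Qed.

(* The second difference of u over a small square of side h is h^2 times
   either mixed derivative at some point of the square. *)
Lemma schwarz {Omega} {u} p : open Omega -> Ck_on 2 Omega u -> Omega p ->
  d1 (d2 u) p = d2 (d1 u) p.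
Proof.
have tri (e r s t : R) : `|r - s| <= e / 2 -> `|r - t| <= e / 2 -> `|s - t| <= e.
  by rewrite !ler_norml; lra.
case: p => x y oO C2u Oxy.
have Cu := Ck_on_W C2u; have Cu1 := Ck_on_d1 C2u; have Cu2 := Ck_on_d2 C2u.
have [dO dO0 HO] := nbhs_square _ _ (open_nbhs_nbhs (conj oO Oxy)).
have cd21 : {for (x, y), continuous (d2 (d1 u))}.
  exact: (Ck_on_continuous (Ck_on_d2 Cu1)).
have cd12 : {for (x, y), continuous (d1 (d2 u))}.
  exact: (Ck_on_continuous (Ck_on_d1 Cu2)).
apply/eqP; rewrite -subr_eq0 -normr_le0; apply/ler_addgt0Pr => e e0; rewrite add0r.
have e20 : 0 < e / 2 by rewrite divr_gt0.
have [e1 e10 H1] := continuous_square _ _ _ cd12 e20.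
have [e2 e20' H2] := continuous_square _ _ _ cd21 e20.
rewrite /= in HO H1 H2.
pose d := Num.min dO (Num.min e1 e2).
have d0 : 0 < d by rewrite !lt_min dO0 e10.
pose h := d / 2.
have h0 : 0 < h by rewrite divr_gt0.
have hd : h < d by rewrite /h; lra.
have nh : `|h| = h by rewrite gtr0_norm.
have add1 (z w : R) : z + w - z = w by ring.
have dd : forall z : R, `|z| <= `|h| -> [/\ `|z| < dO, `|z| < e1 & `|z| < e2].
  move=> z; rewrite nh => /le_lt_trans/(_ hd).
  by rewrite !lt_min => /andP[-> /andP[-> ->]].
have inO s t : `|s| <= `|h| -> `|t| <= `|h| -> Omega (x + s, y + t).
  by move=> /dd[sh _ _] /dd[th _ _]; apply: HO; rewrite add1.
have z0 : `|0 : R| <= `|h| by rewrite normr0.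
have D1 (v : R * R -> R) (s t : R) : Ck_on 1 Omega v -> `|s| <= `|h| -> `|t| <= `|h| ->
    is_derive s 1 (fun s => v (x + s, y + t)) (d1 v (x + s, y + t)).
  move=> Cv sh th.
  apply: (is_derive_shift0 (fun s => v (s, y + t))).
  exact: is_derive_d1 Cv (inO _ _ sh th).
have D2 (v : R * R -> R) (s t : R) : Ck_on 1 Omega v -> `|s| <= `|h| -> `|t| <= `|h| ->
    is_derive t 1 (fun t => v (x + s, y + t)) (d2 v (x + s, y + t)).
  move=> Cv sh th.
  apply: (is_derive_shift0 (fun t => v (x + s, t))).
  exact: is_derive_d2 Cv (inO _ _ sh th).
have [a ah Ea] : exists2 a, `|a| <= `|h| & (u (x + h, y + h) - u (x + h, y + 0))
   - (u (x + 0, y + h) - u (x + 0, y + 0)) =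
   h * (d1 u (x + a, y + h) - d1 u (x + a, y + 0)).
  apply: (MVT_abs (fun s => u (x + s, y + h) - u (x + s, y + 0))
    (fun s => d1 u (x + s, y + h) - d1 u (x + s, y + 0))) => s sh.
  exact: (is_derive_sub (fun s => u (x + s, y + h)) (fun s => u (x + s, y + 0)) s _ _
    (D1 u s h Cu sh (lexx _)) (D1 u s 0 Cu sh z0)).
have [b bh Eb] : exists2 b, `|b| <= `|h| &
    d1 u (x + a, y + h) - d1 u (x + a, y + 0) = h * d2 (d1 u) (x + a, y + b).
  apply: (MVT_abs (fun t => d1 u (x + a, y + t))
    (fun t => d2 (d1 u) (x + a, y + t))) => t th.
  exact: (D2 (d1 u) a t Cu1 ah th).
have [b' bh' Eb'] : exists2 b, `|b| <= `|h| & (u (x + h, y + h) - u (x + 0, y + h))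
   - (u (x + h, y + 0) - u (x + 0, y + 0)) =
   h * (d2 u (x + h, y + b) - d2 u (x + 0, y + b)).
  apply: (MVT_abs (fun t => u (x + h, y + t) - u (x + 0, y + t))
    (fun t => d2 u (x + h, y + t) - d2 u (x + 0, y + t))) => t th.
  exact: (is_derive_sub (fun t => u (x + h, y + t)) (fun t => u (x + 0, y + t)) t _ _
    (D2 u h t Cu (lexx _) th) (D2 u 0 t Cu z0 th)).
have [a' ah' Ea'] : exists2 a, `|a| <= `|h| &
    d2 u (x + h, y + b') - d2 u (x + 0, y + b') = h * d1 (d2 u) (x + a, y + b').
  apply: (MVT_abs (fun s => d2 u (x + s, y + b'))
    (fun s => d1 (d2 u) (x + s, y + b'))) => s sh.
  exact: (D1 (d2 u) s b' Cu2 sh bh').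
(* The four corner values may be grouped by rows or by columns; equating the two results and
   cancelling [h] twice identifies the mixed derivatives at two points near p. *)
have alg (r1 r2 r3 r4 : R) : r1 - r2 - (r3 - r4) = r1 - r3 - (r2 - r4) by ring.
have E := etrans (etrans (congr1 ( *%R h) (esym Ea')) (esym Eb'))
  (etrans (alg _ _ _ _) (etrans Ea (congr1 ( *%R h) Eb))).
have {}E := mulfI (lt0r_neq0 h0) (mulfI (lt0r_neq0 h0) E).
have B1 : `|d1 (d2 u) (x + a', y + b') - d1 (d2 u) (x, y)| <= e / 2.
  by apply: H1; rewrite add1; [have [] := dd _ ah'|have [] := dd _ bh'].
have B2 : `|d2 (d1 u) (x + a, y + b) - d2 (d1 u) (x, y)| <= e / 2.
  by apply: H2; rewrite add1; [have [] := dd _ ah|have [] := dd _ bh].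
apply: (tri _ _ _ _ _ B2).
exact: (@eq_ind _ _ (fun z => `|z - d1 (d2 u) (x, y)| <= e / 2) B1 _ E).
Qed.

End Calculus.

(** * The barrier *)

Section Barrier.
Context {R : realType}.

Lemma is_derive1_littleo (f : R -> R) (a l e : R) :
  is_derive a 1 f l -> 0 < e -> exists2 d, 0 < d & forall h, `|h| < d ->
     `|f (a + h) - f a - h * l| <= e * `|h|.
Proof.
move=> [df dl] e0.
have : (fun h => h^-1 *: ((f \o shift a) (h *: (1:R)) - f a)) @ (0:R)^' --> (l : R).
  by rewrite -dl; exact: df.
move=> /cvgrPdist_le/(_ e e0).
rewrite near_withinE => /nbhs_ballP[d /= d0 H]; exists d => // h hd.
have [->|h0] := eqVneq h 0; first by rewrite addr0 subrr mul0r subrr normr0 mulr0.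
have /(_ h0) : h != 0 -> `|l - h^-1 *: (f (h *: (1:R) + a) - f a)| <= e.
  by apply: H; rewrite -ball_normE /= sub0r normrN.
rewrite [h *: 1]mulr1 [h + a]addrC /GRing.scale /= => H1.
have -> : f (a + h) - f a - h * l = - h * (l - h^-1 * (f (a + h) - f a)).
  by field.
by rewrite normrM normrN mulrC; apply: ler_wpM2r.
Qed.

(** If l were positive, g' would be at least l c / 2 at small c > 0, and the mean value theorem on
    [0, t] would give g t > g 0. *)
Lemma second_derivative_at_max (g g' : R -> R) (l d : R) : 0 < d ->
  (forall t : R, `|t| < d -> is_derive t 1 g (g' t)) -> is_derive (0 : R) 1 g' l ->
  (forall t, `|t| < d -> g t <= g 0) -> g' 0 = 0 /\ l <= 0.
Proof.
move=> d0 dg dg' gmax.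
have g'0 : g' 0 = 0.
  have H1 := dg 0 ltac:(by rewrite normr0).
  have H2 : is_derive (0 : R) 1 g 0.
    apply: (@derive1_at_max _ g (- d) d 0).
    - by lra.
    - by move=> t; rewrite in_itv /= -ltr_norml => /dg[].
    - by rewrite in_itv /=; lra.
    - by move=> t; rewrite in_itv /= -ltr_norml => /gmax.
  by rewrite -(@derive_val _ _ _ _ _ _ _ H1) (@derive_val _ _ _ _ _ _ _ H2).
split=> //; rewrite leNgt; apply/negP => l0.
have [e e0 He] := is_derive1_littleo _ _ _ _ dg' (divr_gt0 l0 (ltr0Sn R 1)).
pose t := Num.min d e / 2.
have de0 : 0 < Num.min d e by rewrite lt_min d0.
have t0 : 0 < t by rewrite divr_gt0.
have [td te] : t < d /\ t < e.
  have : t < Num.min d e by rewrite /t; lra.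
  by rewrite lt_min => /andP[].
have [||c] := @MVT R g g' 0 t t0.
- by move=> x; rewrite in_itv /= => xab; apply: dg; rewrite ltr_norml; lra.
- apply: derivable_within_continuous => x; rewrite in_itv /= => xab.
  by have [] := dg x ltac:(by rewrite ltr_norml; lra).
rewrite in_itv /= => /andP[c0 ct] E.
have : 0 < g' c.
  have := He c; rewrite add0r g'0 subr0 gtr0_norm // ler_norml.
  move=> /(_ (lt_trans ct te)) /andP[+ _].
  have : 0 < l * c by rewrite mulr_gt0.
  lra.
move=> /mulr_gt0/(_ t0).
have := gmax t; rewrite gtr0_norm // => /(_ td).
move: E; rewrite subr0; lra.
Qed.

Lemma is_derive_lin (k l t : R) : is_derive t 1 (fun s => k + l * s) l.
Proof.
have := is_deriveD (is_derive_cst k t (1 : R)) (is_deriveZ l (is_derive_id t (1 : R))).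
by move=> /is_derive_eq; apply; rewrite add0r [LHS]mulr1.
Qed.

Lemma is_derive_mul (f g : R -> R) (t a b : R) :
  is_derive t 1 f a -> is_derive t 1 g b ->
  is_derive t 1 (fun s => f s * g s) (a * g t + f t * b).
Proof.
move=> df dg; have := is_deriveM df dg.
move=> /is_derive_eq; apply; rewrite /GRing.scale /=; ring.
Qed.

Lemma is_derive_quad (al be ga t : R) :
  is_derive t 1 (fun t : R => al + 2 * be * t + ga * t ^+ 2) (2 * (be + ga * t)).
Proof.
have D := is_deriveD (is_derive_lin al (2 * be) t)
  (is_derive_mul _ _ _ _ _ (is_derive_lin 0 ga t) (is_derive_lin 0 1 t)).
rewrite [X in is_derive _ _ X](_ : _ = (fun s => al + 2 * be * s) +
  (fun s : R => (0 + ga * s) * (0 + 1 * s)) :> (R -> R)).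
  by apply: (is_derive_eq D); ring.
by apply/funext => s; rewrite -[RHS]/(_ + _) !add0r mul1r expr2 mulrA.
Qed.

Lemma is_derive_sqrt_quad (al be ga t : R) :
  0 < al + 2 * be * t + ga * t ^+ 2 ->
  is_derive t 1 (fun t => Num.sqrt (al + 2 * be * t + ga * t ^+ 2))
    ((be + ga * t) / Num.sqrt (al + 2 * be * t + ga * t ^+ 2)).
Proof.
move=> s0.
have := @is_derive1_comp _ Num.sqrt (fun t : R => al + 2 * be * t + ga * t ^+ 2) t
  _ _ (is_derive1_sqrt s0) (is_derive_quad al be ga t).
move=> /is_derive_eq; apply.
have : Num.sqrt (al + 2 * be * t + ga * t ^+ 2) != 0 by rewrite gt_eqF // sqrtr_gt0.
by move=> ?; rewrite /GRing.scale /=; field.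
Qed.

(** By the preceding lemma this is the second derivative at 0 of the square root of the quadratic
    polynomial. *)
Lemma is_derive_slope (al be ga : R) : 0 < al ->
  is_derive (0 : R) 1
    (fun t : R => (be + ga * t) / Num.sqrt (al + 2 * be * t + ga * t ^+ 2))
    (ga / Num.sqrt al - be ^+ 2 / Num.sqrt al ^+ 3).
Proof.
move=> al0.
have E0 : al + 2 * be * 0 + ga * 0 ^+ 2 = al by ring.
have s0 : Num.sqrt al != 0 by rewrite gt_eqF // sqrtr_gt0.
have := is_derive_sqrt_quad al be ga 0; rewrite E0 => /(_ al0) H.
have sn : Num.sqrt (al + 2 * be * 0 + ga * 0 ^+ 2) != 0 by rewrite E0.
have HV := @is_deriveV _
  (fun t : R => Num.sqrt (al + 2 * be * t + ga * t ^+ 2)) 0 _ 1 sn H.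
have := is_derive_mul _ _ _ _ _ (is_derive_lin be ga 0) HV.
move=> /is_derive_eq; apply.
rewrite E0 /GRing.scale /=.
by field.
Qed.

Implicit Types (p q c v : R * R) (u : R * R -> R) (Omega : set (R * R)).

Lemma continuous_dist2 c : continuous (fun q => dot (q - c) (q - c)).
Proof.
move=> q; rewrite /dot /=.
have c1 : (fun x : R * R => x.1 - c.1) x @[x --> q] --> q.1 - c.1.
  by apply: cvgB; [exact: cvg_fst|exact: cvg_cst].
have c2 : (fun x : R * R => x.2 - c.2) x @[x --> q] --> q.2 - c.2.
  by apply: cvgB; [exact: cvg_snd|exact: cvg_cst].
by apply: cvgD; apply: cvgM.
Qed.

(* The graph of -A sqrt(|q|^2 - rho^2) moved by the left translation of
   Nil_3(tau) taking the vertical axis over 0 to the one over c; the linear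
   term comes from that translation. *)
Definition barrier (tau A : R) c (rho : R) q : R :=
  - A * Num.sqrt (dot (q - c) (q - c) - rho ^+ 2)
  - tau * (c.2 * q.1 - c.1 * q.2).

(** Along a line the barrier is the square root of a quadratic polynomial plus an affine function,
    which reduces its study to one variable. *)
Lemma barrier_line (tau A : R) c (rho : R) q v (t : R) :
  barrier tau A c rho (q + t *: v) =
  - A * Num.sqrt (dot (q - c) (q - c) - rho ^+ 2 + 2 * dot (q - c) v * t
     + dot v v * t ^+ 2)
  - (tau * (c.2 * q.1 - c.1 * q.2) + tau * (c.2 * v.1 - c.1 * v.2) * t).
Proof.
rewrite /barrier /dot /= /GRing.scale /=; congr (_ * Num.sqrt _ - _); ring.
Qed.

Lemma line_near (P : set (R * R)) q v : nbhs q P ->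
  exists2 d : R, 0 < d & forall t, `|t| < d -> P (q + t *: v).
Proof.
move=> /nbhs_square[d d0 H].
have m0 : 0 < `|v.1| + `|v.2| + 1.
  by have := normr_ge0 v.1; have := normr_ge0 v.2; lra.
exists (d / (`|v.1| + `|v.2| + 1)); first by rewrite divr_gt0.
move=> t; rewrite ltr_pdivlMr // => ht.
have E (a b : R) : a + b - a = b by ring.
rewrite [q + _]surjective_pairing; apply: H; rewrite /= E normrM;
  apply: le_lt_trans ht; apply: ler_wpM2l => //.
  by have := normr_ge0 v.2; lra.
by have := normr_ge0 v.1; lra.
Qed.

(** On the line through q in the direction v, the difference of u and the barrier has a local
    maximum at 0: its first derivative vanishes and its second is nonpositive. Keeping v arbitrary
    avoids computing the Hessian of the barrier. *)
Lemma barrier_contact_line Omega u (tau A : R) c (rho : R) q v :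
  open Omega -> Ck_on 2 Omega u -> Omega q ->
  rho ^+ 2 < dot (q - c) (q - c) ->
  (\forall y \near q, u y - barrier tau A c rho y <= u q - barrier tau A c rho q) ->
  let s := Num.sqrt (dot (q - c) (q - c) - rho ^+ 2) in
  v.1 * d1 u q + v.2 * d2 u q =
    - A * (dot (q - c) v / s) - tau * (c.2 * v.1 - c.1 * v.2) /\
  v.1 ^+ 2 * d1 (d1 u) q + 2 * v.1 * v.2 * d2 (d1 u) q + v.2 ^+ 2 * d2 (d2 u) q
    <= - A * (dot v v / s - dot (q - c) v ^+ 2 / s ^+ 3).
Proof.
move=> oO Cu Oq qc mx s.
have n1 : nbhs q Omega by exact: open_nbhs_nbhs.
have n2 : nbhs q [set y | rho ^+ 2 < dot (y - c) (y - c)].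
  exact: (continuous_dist2 c q _ (lt_nbhsr qc)).
have [d d0 H] := line_near _ _ v (filterI n1 (filterI n2 mx)).
have q0 : q + 0 *: v = q by rewrite scale0r addr0.
set al := dot (q - c) (q - c) - rho ^+ 2 in s *.
have al0 : 0 < al by rewrite subr_gt0.
set be := dot (q - c) v; set ga := dot v v.
pose la := tau * (c.2 * v.1 - c.1 * v.2).
pose ka := tau * (c.2 * q.1 - c.1 * q.2).
pose g t := u (q + t *: v) - (- A * Num.sqrt (al + 2 * be * t + ga * t ^+ 2)
  - (ka + la * t)).
pose g' t := v.1 * d1 u (q + t *: v) + v.2 * d2 u (q + t *: v) -
   (- A * ((be + ga * t) / Num.sqrt (al + 2 * be * t + ga * t ^+ 2)) - la).
have gE t : g t = u (q + t *: v) - barrier tau A c rho (q + t *: v).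
  by rewrite barrier_line.
have pos t : `|t| < d -> 0 < al + 2 * be * t + ga * t ^+ 2.
  move=> /H[_ [+ _]] => /=; rewrite -subr_gt0.
  rewrite (_ : _ - _ = al + 2 * be * t + ga * t ^+ 2) //.
  rewrite /al /be /ga /dot /= /GRing.scale /=; ring.
have dA (f : R -> R) (t l : R) : is_derive t 1 f l ->
    is_derive t 1 (fun s => - A * f s) (- A * l).
  by move=> df; have := is_deriveZ (- A) df.
have dg (t : R) : `|t| < d -> is_derive t 1 g (g' t).
  move=> td; have [Ot _] := H t td.
  apply: is_derive_sub.
    exact/is_derive_line/(is_derive_C1 _ _ oO (Ck_on_W Cu) Ot).
  apply: is_derive_sub; last exact: is_derive_lin.
  exact: dA (is_derive_sqrt_quad _ _ _ _ (pos t td)).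
have dg' : is_derive (0 : R) 1 g'
   (v.1 * (v.1 * d1 (d1 u) q + v.2 * d2 (d1 u) q) +
    v.2 * (v.1 * d1 (d2 u) q + v.2 * d2 (d2 u) q)
    - (- A * (ga / s - be ^+ 2 / s ^+ 3) - 0)).
  have O0 : Omega (q + 0 *: v) by rewrite q0.
  have D1 := is_derive_line _ _ _ _ _ _ (is_derive_C1 _ v oO (Ck_on_d1 Cu) O0).
  have D2 := is_derive_line _ _ _ _ _ _ (is_derive_C1 _ v oO (Ck_on_d2 Cu) O0).
  rewrite q0 in D1; rewrite q0 in D2.
  have D12 := is_deriveD (is_deriveZ v.1 D1) (is_deriveZ v.2 D2).
  have D3 := dA _ _ _ (is_derive_slope _ be ga al0).
  have D4 : is_derive (0 : R) 1 (fun=> la) 0 := is_derive_cst la (0 : R) (1 : R).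
  have D34 := is_derive_sub _ _ _ _ _ D3 D4.
  exact: (is_derive_sub _ _ _ _ _ D12 D34).
have gm t : `|t| < d -> g t <= g 0.
  by move=> /H[_ [_ +]]; rewrite !gE q0.
have [] := second_derivative_at_max g g' _ d d0 dg dg' gm.
rewrite /g' q0 !mulr0 expr0n /= mulr0 !addr0 (schwarz _ oO Cu Oq) -/s -/la.
move: (d1 u q) (d2 u q) (d1 (d1 u) q) (d2 (d1 u) q) (d2 (d2 u) q).
clear; move: (be / s) (ga / s) (be ^+ 2 / s ^+ 3); clear.
move=> bs gs bs3 u1 u2 u11 u12 u22 e1 e2; split; [lra|nra].
Qed.

End Barrier.

(** * Comparison with the barrier *)

Section Comparison.
Context {R : realType}.
Implicit Types (p q c v : R * R) (u : R * R -> R) (Omega : set (R * R)).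

(* Here (z1, z2) = q - c, s2 = s^2 = |z|^2 - rho^2, and (P, Q) is the value of
   (u_1 + tau x_2, u_2 - tau x_1) forced by the contact with the barrier. *)
Lemma barrier_supersolution (tau A rho z1 z2 s P Q : R) :
  0 < s -> s ^+ 2 = z1 ^+ 2 + z2 ^+ 2 - rho ^+ 2 ->
  1 + tau ^+ 2 * rho ^+ 2 <= A ^+ 2 ->
  P = - A * (z1 / s) + tau * z2 ->
  Q = - A * (z2 / s) - tau * z1 ->
  0 < (2 + P ^+ 2 + Q ^+ 2) / s
      - (z1 ^+ 2 + z2 ^+ 2 + (z1 * Q - z2 * P) ^+ 2) / s ^+ 3.
Proof.
move=> s0 s2 hA -> ->.
have sn : s != 0 by rewrite gt_eqF.
rewrite [ltRHS](_ : _ = (2 * s ^+ 2 + A ^+ 2 * (z1 ^+ 2 + z2 ^+ 2) +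
    tau ^+ 2 * (z1 ^+ 2 + z2 ^+ 2) * s ^+ 2
    - (z1 ^+ 2 + z2 ^+ 2) - tau ^+ 2 * (z1 ^+ 2 + z2 ^+ 2) ^+ 2) / s ^+ 3); last by field.
apply: divr_gt0; last by rewrite exprn_gt0.
have m0 : 0 < s ^+ 2 by rewrite exprn_gt0.
have r0 : 0 <= rho ^+ 2 by exact: sqr_ge0.
move: r0 hA m0 s2; clear.
move: (rho ^+ 2) (s ^+ 2) (A ^+ 2) (tau ^+ 2) (z1 ^+ 2) (z2 ^+ 2) => r s2 a t x y.
move=> r0 hA m0 Es; have -> : y = s2 + r - x by lra.
(* The condition on A makes the second summand nonnegative; the first one gives strictness. *)
have -> : 2 * s2 + a * (x + (s2 + r - x)) + t * (x + (s2 + r - x)) * s2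
   - (x + (s2 + r - x)) - t * (x + (s2 + r - x)) ^+ 2 =
   2 * s2 + (s2 + r) * (a - 1 - t * r) by ring.
by apply: ltr_pwDl; [lra|apply: mulr_ge0; lra].
Qed.

(** With P = u_1 + tau x_2 and Q = u_2 - tau x_1, the left side of the minimal surface equation is
    the sum of the second derivatives of u in the directions (1, 0), (0, 1) and (Q, -P). Adding the
    contact inequalities in these directions contradicts [barrier_supersolution]. *)
Lemma barrier_no_interior_contact Omega u (tau A : R) c (rho : R) q :
  open Omega -> Ck_on 2 Omega u -> Omega q -> minimal_surface_eq tau u q ->
  0 < A -> 1 + tau ^+ 2 * rho ^+ 2 <= A ^+ 2 ->
  rho ^+ 2 < dot (q - c) (q - c) ->
  ~ (\forall y \near q,
       u y - barrier tau A c rho y <= u q - barrier tau A c rho q).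
Proof.
move=> oO Cu Oq mse A0 hA qc mx.
have H a b := barrier_contact_line _ _ _ _ _ _ _ (a, b) oO Cu Oq qc mx.
have s0 : 0 < Num.sqrt (dot (q - c) (q - c) - rho ^+ 2).
  by rewrite sqrtr_gt0 subr_gt0.
have s2 : Num.sqrt (dot (q - c) (q - c) - rho ^+ 2) ^+ 2 =
    (q.1 - c.1) ^+ 2 + (q.2 - c.2) ^+ 2 - rho ^+ 2.
  by rewrite sqr_sqrtr ?subr_ge0 ?ltW // /dot /= -!expr2.
have S := barrier_supersolution tau A _ _ _ _ _ _ s0 s2 hA erefl erefl.
have [E1 L1] := H 1 0; have [E2 L2] := H 0 1.
have [_ L3] := H (d2 u q - tau * q.1) (- (d1 u q + tau * q.2)).
move: mse S E1 L1 E2 L2 L3 s0 A0; rewrite /minimal_surface_eq /dot /=.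
move: (Num.sqrt _) (d1 u q) (d2 u q) (d1 (d1 u) q) (d2 (d1 u) q) (d2 (d2 u) q).
clear; case: q c => q1 q2 [c1 c2] /= s u1 u2 u11 u12 u22.
move=> mse S E1 L1 E2 L2 L3 s0 A0.
have sn : s != 0 by rewrite gt_eqF.
(* The linear term of the barrier replaces q by q - c in the terms with tau, so the computation
   proceeds as if the centre were 0. *)
have {E1}E1 : u1 + tau * q2 = - A * ((q1 - c1) / s) + tau * (q2 - c2).
  have {E1} : u1 = - A * ((q1 - c1) / s) - tau * c2.
    by move: E1; rewrite !mul1r !mul0r !mulr1 !mulr0 !addr0 subr0.
  by move=> ->; ring.
have {E2}E2 : u2 - tau * q1 = - A * ((q2 - c2) / s) - tau * (q1 - c1).
  have {E2} : u2 = - A * ((q2 - c2) / s) + tau * c1.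
    by move: E2; rewrite !mul1r !mul0r !mulr1 !mulr0 !add0r mulrN opprK.
  by move=> ->; ring.
move: mse S L1 L2 L3; rewrite -E1 -E2.
move: (u1 + _) (u2 - _) => P Q; clear E1 E2 u1 u2.
move: (q1 - c1) (q2 - c2); clear q1 q2 c1 c2 => z1 z2 mse S L1 L2 L3.
have AS := mulr_gt0 A0 S.
have EE : - A * ((1 * 1 + 0 * 0) / s - (z1 * 1 + z2 * 0) ^+ 2 / s ^+ 3)
  + - A * ((0 * 0 + 1 * 1) / s - (z1 * 0 + z2 * 1) ^+ 2 / s ^+ 3)
  + - A * ((Q * Q + - P * - P) / s - (z1 * Q + z2 * - P) ^+ 2 / s ^+ 3)
  = - (A * ((2 + P ^+ 2 + Q ^+ 2) / s -
          (z1 ^+ 2 + z2 ^+ 2 + (z1 * Q - z2 * P) ^+ 2) / s ^+ 3)).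
  by field.
have FF : (1 ^+ 2 * u11 + 2 * 1 * 0 * u12 + 0 ^+ 2 * u22) +
  (0 ^+ 2 * u11 + 2 * 0 * 1 * u12 + 1 ^+ 2 * u22) +
  (Q ^+ 2 * u11 + 2 * Q * - P * u12 + (- P) ^+ 2 * u22) = 0.
  by apply: etrans mse; ring.
have : 0 <= - (A * ((2 + P ^+ 2 + Q ^+ 2) / s -
          (z1 ^+ 2 + z2 ^+ 2 + (z1 * Q - z2 * P) ^+ 2) / s ^+ 3)).
  by have := lerD (lerD L1 L2) L3; rewrite FF EE.
by rewrite oppr_ge0 leNgt AS.
Qed.

(* At the rim the barrier decreases like a square root, faster than any
   differentiable function. *)
Lemma barrier_no_rim_contact Omega u (tau A : R) c (rho : R) q :
  open Omega -> Ck_on 1 Omega u -> Omega q ->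
  0 < A -> 0 < rho -> rho ^+ 2 = dot (q - c) (q - c) ->
  ~ (\forall y \near q, rho ^+ 2 <= dot (y - c) (y - c) ->
       u y - barrier tau A c rho y <= u q - barrier tau A c rho q).
Proof.
move=> oO Cu Oq A0 r0 qc mx.
have q0 : q + 0 *: (q - c) = q by rewrite scale0r addr0.
have Oq0 : Omega (q + 0 *: (q - c)) by rewrite q0.
have D := is_derive_line _ _ _ _ _ _ (is_derive_C1 _ (q - c) oO Cu Oq0).
have [d d0 H] := line_near _ _ (q - c) mx.
have [e e0 He] := is_derive1_littleo _ _ _ _ D ltr01.
move: He; rewrite !q0; move: ((q - c).1 * _ + _) => L He.
pose la := tau * (c.2 * (q - c).1 - c.1 * (q - c).2).
(* Moving by a small t > 0 along the ray from c, u minus the linear part of the barrier drops by at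
   most M t. *)
have [M M1 ML] : exists2 M : R, 1 <= M & - M <= L + la - 1.
  by exists (1 + `|L + la|); rewrite ?lerDl //; have := ler_norm (- (L + la));
    rewrite normrN; lra.
have M0 : 0 < M by apply: lt_le_trans M1.
(* The ray parameter will be k^2: there the square root term gains at least A rho k, which beats M
   k^2 as soon as k < A rho / M. The bound by 1 gives k^2 <= k, so [d] and [e] also bound k^2. *)
pose k := Num.min 1 (Num.min (A * rho / M) (Num.min d e)) / 2.
have m0 : 0 < Num.min 1 (Num.min (A * rho / M) (Num.min d e)).
  by rewrite !lt_min ltr01 d0 e0 divr_gt0 ?mulr_gt0.
have k0 : 0 < k by rewrite divr_gt0.
have : k < Num.min 1 (Num.min (A * rho / M) (Num.min d e)).
  by rewrite /k ltr_pdivrMr // ltr_pMr // ltr1n.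
rewrite !lt_min => /and4P[k1 kA kd ke].
have kk : k ^+ 2 <= k by rewrite expr2 ger_pMr // ltW.
have k20 : 0 < k ^+ 2 by rewrite exprn_gt0.
have nk : `|k ^+ 2| = k ^+ 2 by rewrite gtr0_norm.
have := H (k ^+ 2); rewrite nk => /(_ (le_lt_trans kk kd)).
have := He (k ^+ 2); rewrite nk add0r => /(_ (le_lt_trans kk ke)).
have Eb := barrier_line tau A c rho q (q - c) (k ^+ 2).
have Eb0 : barrier tau A c rho q = - (tau * (c.2 * q.1 - c.1 * q.2)).
  by rewrite /barrier -qc subrr sqrtr0 mulr0 add0r.
have Ed : dot (q + k ^+ 2 *: (q - c) - c) (q + k ^+ 2 *: (q - c) - c) =
    dot (q - c) (q - c) * (1 + k ^+ 2) ^+ 2.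
  by rewrite /dot /= /GRing.scale /=; ring.
rewrite Eb Eb0 Ed -!qc subrr add0r.
have sq : rho * k <= Num.sqrt (2 * rho ^+ 2 * k ^+ 2 + rho ^+ 2 * (k ^+ 2) ^+ 2).
  have rk : 0 <= rho * k by rewrite mulr_ge0 ?ltW.
  rewrite -[leLHS](ger0_norm rk) -sqrtr_sqr; apply: ler_wsqrtr.
  have := sqr_ge0 (rho * k ^+ 2); have := sqr_ge0 (rho * k).
  rewrite !exprMn; lra.
move=> B1 /(_ _).
have -> : rho ^+ 2 <= rho ^+ 2 * (1 + k ^+ 2) ^+ 2.
  by apply: ler_peMr; [exact: sqr_ge0|rewrite expr_ge1 //; lra].
move=> /(_ isT).
have Ak := ler_wpM2l (ltW A0) sq.
have kM : M * k ^+ 2 < A * (rho * k).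
  by move: kA; rewrite ltr_pdivlMr // -(ltr_pM2r k0) expr2; lra.
have := ler_wpM2r (ltW k20) ML.
move: B1; rewrite ler_norml -/la => /andP[B1 _].
move: B1 Ak kM k20; rewrite [u _ - u q]addrC.
move: (Num.sqrt _) (u (q + _)) (u q) => S ut uq.
move: (A * (rho * k)) => Ark.
clear; move: (k ^+ 2) (tau * (c.2 * q.1 - c.1 * q.2)) => kk ka.
clearbody la.
nra.
Qed.

Lemma continuous_barrier (tau A : R) c (rho : R) :
  continuous (barrier tau A c rho).
Proof.
move=> q; apply: cvgB; apply: cvgM; try exact: cvg_cst.
  apply: (continuous_comp (f := fun q => dot (q - c) (q - c) - rho ^+ 2));
    last exact: sqrt_continuous.
  by apply: cvgB; [exact: continuous_dist2|exact: cvg_cst].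
by apply: cvgB; apply: cvgM; try exact: cvg_cst; [exact: cvg_fst|exact: cvg_snd].
Qed.

(** By compactness the difference attains its maximum on S, and the two contact lemmas exclude every
    point outside E. Neighbourhoods are taken relative to the exterior of the disc because S may
    touch the rim. *)
Lemma barrier_comparison Omega u (tau A : R) c (rho : R) (S E : set (R * R)) :
  open Omega -> Ck_on 2 Omega u ->
  (forall q, Omega q -> minimal_surface_eq tau u q) ->
  0 < A -> 0 < rho -> 1 + tau ^+ 2 * rho ^+ 2 <= A ^+ 2 ->
  compact S -> {within S, continuous u} ->
  (forall q, S q -> rho ^+ 2 <= dot (q - c) (q - c)) ->
  (forall q, S q -> ~ E q -> Omega q /\
     \forall y \near q, rho ^+ 2 <= dot (y - c) (y - c) -> S y) ->
  forall x, S x -> exists2 e, S e /\ E e &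
    u x - barrier tau A c rho x <= u e - barrier tau A c rho e.
Proof.
move=> oO Cu mse A0 r0 hA cS cu Src SE x Sx.
have cuw : {within S, continuous (fun q => u q - barrier tau A c rho q)}.
  move=> q; apply: cvgB; first exact: cu.
  exact: (continuous_subspaceT (@continuous_barrier tau A c rho)).
have [q /set_mem Sq qmax] := compact_EVT_max (ex_intro _ _ Sx) cS cuw.
exists q; last exact/qmax/mem_set.
split=> //; apply: contrapT => /(SE q Sq)[Oq nS].
have mx : \forall y \near q, rho ^+ 2 <= dot (y - c) (y - c) ->
       u y - barrier tau A c rho y <= u q - barrier tau A c rho q.
  by apply: filterS nS => y Sy ry; exact/qmax/mem_set/Sy.
have := Src q Sq; rewrite le_eqVlt => /orP[/eqP rq|rq].
  exact: (barrier_no_rim_contact _ _ _ _ _ _ _ oO (Ck_on_W Cu) Oq A0 r0 rq mx).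
apply: (barrier_no_interior_contact _ _ _ _ _ _ _ oO Cu Oq (mse q Oq) A0 hA rq).
have n2 : nbhs q [set y | rho ^+ 2 < dot (y - c) (y - c)].
  exact: (continuous_dist2 c q _ (lt_nbhsr rq)).
by apply: filterS2 mx n2 => y + /ltW; apply.
Qed.

(** The square root at p has a favourable sign and is dropped; the one at q is at most sqrt(8) M.
    The bound does not involve rho, so it is uniform over discs sharing the same A. *)
Lemma barrier_oscillation (tau A M : R) c (rho : R) p q : 0 < A ->
  `|c.1| <= M -> `|c.2| <= M -> `|p.1| <= M -> `|p.2| <= M ->
  `|q.1| <= M -> `|q.2| <= M ->
  barrier tau A c rho p - barrier tau A c rho q
    <= 4 * A * M + 4 * `|tau| * M ^+ 2.
Proof.
move=> A0 c1 c2 p1 p2 q1 q2.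
have M0 : 0 <= M by apply: le_trans c1.
have tri (a b : R) : `|a| <= M -> `|b| <= M -> `|a - b| <= 2 * M.
  by rewrite !ler_norml; lra.
have sq (a b : R) : `|a| <= M -> `|b| <= M -> (a - b) * (a - b) <= 4 * M ^+ 2.
  move=> aM bM; rewrite -expr2 -real_normK ?num_real //.
  have -> : 4 * M ^+ 2 = (2 * M) ^+ 2 by ring.
  by rewrite ler_pXn2r ?nnegrE ?tri // mulr_ge0.
have Bq : A * Num.sqrt (dot (q - c) (q - c) - rho ^+ 2) <= 4 * A * M.
  rewrite [4 * A]mulrC -mulrA; apply: ler_wpM2l; first exact: ltW.
  have M40 : 0 <= 4 * M by rewrite mulr_ge0.
  rewrite -[leRHS](ger0_norm M40) -sqrtr_sqr; apply: ler_wsqrtr.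
  rewrite /dot /= exprMn.
  have := sq _ _ q1 c1; have := sq _ _ q2 c2; have := sqr_ge0 rho.
  have := sqr_ge0 M; lra.
have Bp : 0 <= A * Num.sqrt (dot (p - c) (p - c) - rho ^+ 2).
  by rewrite mulr_ge0 ?sqrtr_ge0 ?ltW.
have Bl : tau * (c.2 * q.1 - c.1 * q.2) - tau * (c.2 * p.1 - c.1 * p.2)
    <= 4 * `|tau| * M ^+ 2.
  have -> : tau * (c.2 * q.1 - c.1 * q.2) - tau * (c.2 * p.1 - c.1 * p.2) =
    tau * (c.2 * (q.1 - p.1) + c.1 * (p.2 - q.2)) by ring.
  apply: (le_trans (ler_norm _)); rewrite normrM.
  rewrite [4 * _]mulrC -mulrA; apply: ler_wpM2l => //.
  apply: (le_trans (ler_normD _ _)); rewrite !normrM.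
  have -> : 4 * M ^+ 2 = M * (2 * M) + M * (2 * M) by ring.
  by apply: lerD; apply: ler_pM => //; exact: tri.
rewrite /barrier !mulNr; move: Bq Bp Bl; clear.
move: (A * Num.sqrt _) (A * Num.sqrt _) (tau * (c.2 * q.1 - _)) (tau * (c.2 * p.1 - _)).
by move=> ? ? ? ?; lra.
Qed.

End Comparison.

(** * A concave boundary point *)

Section ConcavePoint.
Context {R : realType}.
Implicit Types (p q c v x y z : R * R) (Omega : set (R * R)).

Definition segment_in Omega x z : Prop :=
  forall t : R, 0 <= t <= 1 -> Omega (x + t *: (z - x)).

Lemma segment_in_sym Omega x z : segment_in Omega x z -> segment_in Omega z x.
Proof.
move=> xz t t01; have := xz (1 - t) ltac:(lra).
rewrite (_ : x + (1 - t) *: (z - x) = z + t *: (x - z)) //.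
by congr pair; rewrite /= /GRing.scale /=; ring.
Qed.

(* The directions pointing from p into a convex Omega form an open cone C
   disjoint from -C; were all lines through p to meet Omega, C and -C would
   disconnect a path joining opposite directions. *)
Lemma nonconvex_segment Omega : open Omega -> ~ convex_boundary Omega ->
  ~ (forall x z, Omega x -> Omega z -> segment_in Omega x z).
Proof.
move=> oO + cO; apply => p [_ pO].
have {}pO : ~ Omega p by move=> Op; apply: pO; exact: open_nbhs_nbhs.
apply: contrapT => nd.
have meet (d : R * R) : d != 0 -> exists t : R, Omega (p + t *: d).
  move=> d0; apply: contrapT => nt; apply: nd; exists d => // q Oq [t _ qE].
  by apply: nt; exists t; rewrite qE.
pose C := [set v : R * R | exists2 s : R, 0 < s & Omega (p + s *: v)].
have CN v : C v -> C (- v) -> False.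
  move=> [s s0 Os] [t t0 Ot]; apply: pO.
  have st : s + t != 0 by rewrite gt_eqF // addr_gt0.
  have := cO _ _ Os Ot (s / (s + t)) _.
  rewrite (_ : _ + _ *: _ = p).
    apply; have st0 : 0 < s + t by rewrite addr_gt0.
    by rewrite divr_ge0 ?(ltW s0) ?(ltW st0) //= ler_pdivrMr // mul1r lerDl ltW.
  rewrite [RHS]surjective_pairing.
  by congr pair; rewrite /= /GRing.scale /=; field.
have CU v : v != 0 -> C v \/ C (- v).
  move=> /meet[t Ot]; have [t0|t0|t0] := ltgtP t 0.
  - by right; exists (- t); rewrite ?oppr_gt0 // scaleNr scalerN opprK.
  - by left; exists t.
  - by move: Ot; rewrite t0 scale0r addr0.
have oC : open C.
  rewrite openE => v [s s0 Os].
  have cv : continuous (fun v : R * R => p + s *: v).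
    by move=> w; apply: cvgD; [exact: cvg_cst|apply: cvgZr; exact: cvg_id].
  have : nbhs v ((fun v : R * R => p + s *: v) @^-1` Omega).
    by apply: cv; exact: open_nbhs_nbhs.
  by apply: filterS => w Ow; exists s.
have path_absurd (a : R) : a != 0 -> C (a, 0) -> False.
  move=> a0 Ca.
  (* An arc of parabola from (a, 0) to (-a, 0) that avoids 0: the first coordinate vanishes only at
     t = 1/2, where the second is 1/4. *)
  pose e (t : R) : R * R := ((1 - 2 * t) * a, t * (1 - t)).
  have ce : continuous e.
    move=> t.
    have c1 : (1 - 2 * s) * a @[s --> t] --> (1 - 2 * t) * a.
      apply: cvgM; last exact: cvg_cst.
      by apply: cvgB; [exact: cvg_cst|apply: cvgM; [exact: cvg_cst|exact: cvg_id]].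
    have c2 : s * (1 - s) @[s --> t] --> t * (1 - t).
      by apply: cvgM; [exact: cvg_id|apply: cvgB; [exact: cvg_cst|exact: cvg_id]].
    exact: (cvg_pair c1 c2).
  have e0 t : e t != 0.
    apply/eqP => -[/eqP]; rewrite mulf_eq0 (negbTE a0) orbF => /eqP e1.
    have -> : t = 1 / 2 by lra.
    by move=> /eqP; rewrite mulf_eq0; lra.
  (* The times spent in C form a nonempty open subset of [0, 1], also closed since a nonzero vector
     lies in exactly one of C and -C. Hence (-a, 0) is in C too. *)
  have H : `[0, 1]%classic `&` e @^-1` C = `[0, 1]%classic.
    apply: (@segment_connected R 0 1).
    - exists 0; split; first by rewrite /= in_itv /=; lra.
      by rewrite /= /e mulr0 subr0 !mul1r mul0r.
    - exists (e @^-1` C) => //.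
      by apply: open_comp => // ? _; exact: ce.
    - exists (~` (e @^-1` [set v | C (- v)])).
        rewrite closedC; apply: open_comp => [? _|]; first exact: ce.
        by apply: open_comp => // ? _; exact: opp_continuous.
      congr (_ `&` _); apply/seteqP; split => t /=.
        by move=> Ct CNt; exact: CN Ct CNt.
      by have [] := CU _ (e0 t).
  have /(_ 1) : `[0, 1]%classic `<=` `[0, 1]%classic `&` e @^-1` C by rewrite H.
  case; first by rewrite /= in_itv /=; lra.
  move=> _ /= C1; apply: CN Ca _.
  by move: C1; rewrite /e; congr C; congr pair; rewrite /=; ring.
have [C1|] := CU (1, 0) ltac:(by rewrite xpair_eqE oner_eq0).
  exact: path_absurd (oner_neq0 _) C1.
have -> : - (1, 0) = (-1, 0) :> R * R by congr pair; rewrite /= oppr0.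
by apply: path_absurd; rewrite oppr_eq0 oner_eq0.
Qed.

Lemma segment_in_near Omega x : open Omega -> Omega x ->
  \forall z \near x, segment_in Omega x z.
Proof.
move=> oO Ox.
have [d d0 H] := nbhs_square _ _ (open_nbhs_nbhs (conj oO Ox)).
apply/nbhs_ballP; exists d => // -[z1 z2] [].
rewrite -!ball_normE /= => h1 h2 t /andP[t0 t1].
have E (r s : R) : r + s - r = s by ring.
rewrite [x + _]surjective_pairing; apply: H; rewrite /= E normrM (ger0_norm t0).
  by rewrite distrC; apply: le_lt_trans h1; rewrite ler_piMl.
by rewrite distrC; apply: le_lt_trans h2; rewrite ler_piMl.
Qed.

(** Without such a triple, being joined by a segment inside Omega would be transitive. It is
    symmetric and holds near each point, so the class of x would be open and relatively closed,
    hence all of Omega. *)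
Lemma broken_segment Omega : open Omega -> connected Omega ->
  ~ (forall x z, Omega x -> Omega z -> segment_in Omega x z) ->
  exists x y z,
    [/\ segment_in Omega y x, segment_in Omega y z & ~ segment_in Omega x z].
Proof.
move=> oO cO; apply: contra_notP => nt x z Ox Oz.
have trans y x' z' : segment_in Omega y x' -> segment_in Omega y z' ->
    segment_in Omega x' z'.
  by move=> yx yz; apply: contrapT => xz; apply: nt; exists x', y, z'.
have end_in a b : segment_in Omega a b -> Omega b.
  by move=> /(_ 1); rewrite scale1r subrKC lexx ler01; apply.
pose B := [set z' | segment_in Omega x z'].
have BO : B `<=` Omega by move=> b /end_in.
suff : B = Omega by move=> BE; have : B z by rewrite BE.
apply: cO.
- exists x => t _; by rewrite subrr scaler0 addr0.
- exists B; last by rewrite (setIidr BO).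
  rewrite openE => b Bb; have := segment_in_near _ _ oO (BO _ Bb).
  by apply: filterS => w bw; exact: trans (segment_in_sym _ _ _ Bb) bw.
- exists (~` (Omega `\` B)); last first.
    by apply/seteqP; split=> [b Bb|b [Ob]]; [split; [exact: BO|case]|
       move=> nOB; apply: contrapT => nB; exact: nOB].
  rewrite closedC openE => b [Ob nBb].
  have := segment_in_near _ _ oO Ob.
  apply: filterS => w bw; split; first exact: end_in bw.
  move=> Bw; apply: nBb.
  exact: trans (segment_in_sym _ _ _ Bw) (segment_in_sym _ _ _ bw).
Qed.

Lemma compact_in_box (A : set (R * R)) (M : R) : closed A ->
  (forall q, A q -> `|q.1| <= M /\ `|q.2| <= M) -> compact A.
Proof.
move=> clA AM.
apply: (subclosed_compact clA (compact_setX (@segment_compact R (- M) M)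
  (@segment_compact R (- M) M))).
by move=> q /AM[]; rewrite !ler_norml => q1 q2; split; rewrite /= in_itv.
Qed.

(** When the three points are aligned, [x, z] is covered by [y, x] and [y, z]; this disposes of
    degenerate triangles. *)
Lemma segment_in_collinear Omega x y z :
  (x - y).1 * (z - y).2 - (x - y).2 * (z - y).1 = 0 ->
  segment_in Omega y x -> segment_in Omega y z -> segment_in Omega x z.
Proof.
move=> det0 yx yz t /andP[t0 t1].
have E : x + t *: (z - x) = y + (1 - t) *: (x - y) + t *: (z - y).
  rewrite [LHS]surjective_pairing [RHS]surjective_pairing.
  by congr pair; rewrite /= /GRing.scale /=; ring.
rewrite {}E; move: yx yz det0; rewrite /segment_in.
move: (x - y) (z - y) => [a1 a2] [b1 b2] /= Ha Hb det0.
have [/eqP|a0] := eqVneq (a1 ^+ 2 + a2 ^+ 2) 0.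
  rewrite paddr_eq0 ?sqr_ge0 // !sqrf_eq0 => /andP[/eqP-> /eqP->].
  have -> : (0, 0) = 0 :> R * R by [].
  by rewrite scaler0 addr0; apply: Hb; rewrite t0.
pose l := (a1 * b1 + a2 * b2) / (a1 ^+ 2 + a2 ^+ 2).
have b1E : b1 = l * a1.
  apply: (mulIf a0); rewrite /l mulrAC divfK //.
  have -> : (a1 * b1 + a2 * b2) * a1 = a1 ^+ 2 * b1 + a2 * (a1 * b2) by ring.
  by have -> : a1 * b2 = a2 * b1 by [lra]; ring.
have b2E : b2 = l * a2.
  apply: (mulIf a0); rewrite /l mulrAC divfK //.
  have -> : (a1 * b1 + a2 * b2) * a2 = a2 ^+ 2 * b2 + a1 * (a2 * b1) by ring.
  by have <- : a1 * b2 = a2 * b1 by [lra]; ring.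
have E : y + (1 - t) *: (a1, a2) + t *: (b1, b2) =
    y + (1 - t + t * l) *: (a1, a2).
  rewrite [LHS]surjective_pairing [RHS]surjective_pairing.
  by congr pair; rewrite /= /GRing.scale /= ?b1E ?b2E; ring.
have E' : l != 0 -> y + (1 - t) *: (a1, a2) + t *: (b1, b2) =
    y + ((1 - t) / l + t) *: (b1, b2).
  move=> l0; rewrite [LHS]surjective_pairing [RHS]surjective_pairing.
  by congr pair; rewrite /= /GRing.scale /= ?b1E ?b2E; field.
clear b1E b2E det0 a0; clearbody l.
(* In the unit x - y with origin y, the point has coordinate 1 - t + t l. Between 0 and 1 it lies on
   [y, x]; a negative value forces l < 0 and a value above 1 forces l > 1, and then its coordinate
   in the unit z - y is between 0 and 1. *)
have [s0|s0] := ltP (1 - t + t * l) 0.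
  have l0 : l < 0 by nra.
  have ln : l != 0 by rewrite lt_eqF.
  rewrite (E' ln); apply: Hb.
  have := mulVf ln; have : l^-1 < 0 by rewrite invr_lt0.
  by move: (l^-1) => k k0 kl; apply/andP; split; nra.
have [s1|s1] := leP (1 - t + t * l) 1; first by rewrite E; apply: Ha; rewrite s0.
have l1 : 1 < l by nra.
have ln : l != 0 by rewrite gt_eqF // (lt_trans ltr01).
rewrite (E' ln); apply: Hb.
have := mulVf ln; have : 0 < l^-1 by rewrite invr_gt0 (lt_trans ltr01).
by move: (l^-1) => k k0 kl; apply/andP; split; nra.
Qed.

(* p is a point of the complement of Omega in the triangle x y z that is
   farthest from a centre c lying far away on the other side of [x, z]. *)
Lemma concave_point Omega x y z : open Omega ->
  segment_in Omega y x -> segment_in Omega y z -> ~ segment_in Omega x z ->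
  exists p c (e : R),
    [/\ ~ Omega p, 0 < e, 0 < dot (p - c) (p - c) &
      forall q, dot (q - p) (q - p) < e ^+ 2 ->
        dot (p - c) (p - c) < dot (q - c) (q - c) -> Omega q].
Proof.
move=> oO yx yz nxz.
have [det0|det0] := eqVneq ((x - y).1 * (z - y).2 - (x - y).2 * (z - y).1) 0.
  by case: nxz; exact: segment_in_collinear det0 yx yz.
have Ox : Omega x by have := yx 1; rewrite scale1r subrKC lexx ler01; apply.
have Oz : Omega z by have := yz 1; rewrite scale1r subrKC lexx ler01; apply.
have [dx dx0 Hx] := line_near _ _ (x - y) (open_nbhs_nbhs (conj oO Ox)).
have [dz dz0 Hz] := line_near _ _ (z - y) (open_nbhs_nbhs (conj oO Oz)).
(* Both sides from y extend by the ratio d beyond x and z inside Omega; the enlarged triangle will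
   keep p away from its third side. *)
have [d [d0 ddx ddz]] : exists d : R, [/\ 0 < d, d < dx & d < dz].
  exists (Num.min dx dz / 2).
  have m0 : 0 < Num.min dx dz by rewrite lt_min dx0.
  have : Num.min dx dz / 2 < Num.min dx dz by rewrite ltr_pdivrMr // ltr_pMr // ltr1n.
  by rewrite divr_gt0 // lt_min => /andP[].
have {dx0 Hx ddx}sx s : 0 <= s -> s <= 1 + d -> Omega (y + s *: (x - y)).
  move=> s0 sd; have [s1|s1] := leP s 1; first by apply: yx; rewrite s0.
  have := Hx (s - 1); rewrite gtr0_norm ?subr_gt0 // => /(_ ltac:(lra)).
  rewrite (_ : x + _ = y + s *: (x - y)) //.
  rewrite [LHS]surjective_pairing [RHS]surjective_pairing.
  by congr pair; rewrite /= /GRing.scale /=; ring.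
have {dz0 Hz ddz}sz s : 0 <= s -> s <= 1 + d -> Omega (y + s *: (z - y)).
  move=> s0 sd; have [s1|s1] := leP s 1; first by apply: yz; rewrite s0.
  have := Hz (s - 1); rewrite gtr0_norm ?subr_gt0 // => /(_ ltac:(lra)).
  rewrite (_ : z + _ = y + s *: (z - y)) //.
  rewrite [LHS]surjective_pairing [RHS]surjective_pairing.
  by congr pair; rewrite /= /GRing.scale /=; ring.
have [t /andP[t0 t1] nt] : exists2 t : R, 0 <= t <= 1 & ~ Omega (x + t *: (z - x)).
  by apply: contrapT => nt; apply: nxz => t t01; apply: contrapT => ?; apply: nt; exists t.
have {yx yz nxz Ox Oz} nt : ~ Omega (y + (1 - t) *: (x - y) + t *: (z - y)).
  rewrite (_ : _ + _ = x + t *: (z - x)) //.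
  rewrite [LHS]surjective_pairing [RHS]surjective_pairing.
  by congr pair; rewrite /= /GRing.scale /=; ring.
move: (x - y) (z - y) det0 sx sz nt => {x z} [a1 a2] [b1 b2] /=.
case: y => y1 y2; set D := a1 * b2 - _ => det0 sx sz nt.
(* S and T are the affine coordinates with origin y and axes x - y and z - y. *)
pose S q := ((q.1 - y1) * b2 - (q.2 - y2) * b1) / D.
pose T q := (a1 * (q.2 - y2) - a2 * (q.1 - y1)) / D.
have STE q : q = (y1 + S q * a1 + T q * b1, y2 + S q * a2 + T q * b2).
  rewrite [LHS]surjective_pairing.
  by congr pair; rewrite /S /T /D; field.
have cS : continuous S.
  move=> q; apply: cvgM; last exact: cvg_cst.
  by apply: cvgB; apply: cvgM; try exact: cvg_cst; apply: cvgB;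
    try exact: cvg_cst; [exact: cvg_fst|exact: cvg_snd].
have cT : continuous T.
  move=> q; apply: cvgM; last exact: cvg_cst.
  by apply: cvgB; apply: cvgM; try exact: cvg_cst; apply: cvgB;
    try exact: cvg_cst; [exact: cvg_snd|exact: cvg_fst].
have cST : continuous (fun q => S q + T q) by move=> q; apply: cvgD; [exact: cS|exact: cT].
pose K := [set q | [/\ 0 <= S q, 0 <= T q, S q + T q <= 1 + d & ~ Omega q]].
pose M := `|y1| + `|y2| + (1 + d) * (`|a1| + `|a2|) + (1 + d) * (`|b1| + `|b2|).
have KM q : K q -> `|q.1| <= M /\ `|q.2| <= M.
  move=> [s0 u0 su _].
  have tri (r s s' e f : R) : 0 <= s -> s <= 1 + d -> 0 <= s' -> s' <= 1 + d ->
    `|r + s * e + s' * f| <= `|r| + (1 + d) * `|e| + (1 + d) * `|f|.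
    move=> h1 h2 h3 h4; apply: (le_trans (ler_normD _ _)); apply: lerD; last first.
      by rewrite normrM (ger0_norm h3); apply: ler_wpM2r.
    apply: (le_trans (ler_normD _ _)); apply: lerD => //.
    by rewrite normrM (ger0_norm h1); apply: ler_wpM2r.
  have [sd ud] : S q <= 1 + d /\ T q <= 1 + d by split; lra.
  have := tri y1 _ _ a1 b1 s0 sd u0 ud; have := tri y2 _ _ a2 b2 s0 sd u0 ud.
  have d1 : 0 <= 1 + d by lra.
  have H (r : R) := mulr_ge0 d1 (normr_ge0 r).
  have := H a1; have := H a2; have := H b1; have := H b2.
  have := normr_ge0 y1; have := normr_ge0 y2.
  have /= E1 := congr1 fst (STE q); have /= E2 := congr1 snd (STE q).
  rewrite -E1 -E2; clear E1 E2 STE; rewrite /M.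
  move: (`|q.1|) (`|q.2|) (`|a1|) (`|a2|) (`|b1|) (`|b2|) (`|y1|) (`|y2|).
  by clear => *; split; lra.
have clK : closed K.
  have -> : K = S @^-1` [set r | 0 <= r] `&` (T @^-1` [set r | 0 <= r] `&`
     ((fun q => S q + T q) @^-1` [set r | r <= 1 + d] `&` ~` Omega)).
    by apply/seteqP; split=> q [] // ? [? []].
  apply: closedI; first by apply: closed_comp; [move=> ? _; exact: cS|exact: closed_ge].
  apply: closedI; first by apply: closed_comp; [move=> ? _; exact: cT|exact: closed_ge].
  apply: closedI; first by apply: closed_comp; [move=> ? _; exact: cST|exact: closed_le].
  exact: open_closedC.
pose q0 : R * R := (y1 + (1 - t) * a1 + t * b1, y2 + (1 - t) * a2 + t * b2).
have Sq0 : S q0 = 1 - t by rewrite /S /q0 /= /D; field.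
have Tq0 : T q0 = t by rewrite /T /q0 /= /D; field.
have Kq0 : K q0 by split; rewrite ?Sq0 ?Tq0 //; lra.
(* The gradient of S + T, hence a normal to the line through x and z, pointing away from y. *)
pose n : R * R := ((b2 - a2) / D, (a1 - b1) / D).
have STn q : S q + T q = 1 + dot n (q - q0).
  by rewrite /S /T /dot /n /q0 /= /D; field.
have n0 : 0 < dot n n.
  rewrite lt0r addr_ge0 -?expr2 ?sqr_ge0 // andbT paddr_eq0 ?sqr_ge0 //.
  apply/negP; rewrite !sqrf_eq0 => /andP[/eqP e1 /eqP e2].
  have : n.1 * a1 + n.2 * a2 = 1 by rewrite /n /= /D; field.
  by rewrite e1 e2 !mul0r addr0 => /esym/eqP; rewrite oner_eq0.
(* The squared distance from [q0] to a point of K is at most 8 M^2, and 2 N d exceeds this by 1: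
   points with S + T = 1 + d are then closer to c than [q0] is. *)
pose N := (8 * M ^+ 2 + 1) / (2 * d).
have N0 : 0 < N.
  by rewrite divr_gt0 ?mulr_gt0 // ltr_wpDl // mulr_ge0 ?sqr_ge0.
pose c : R * R := (q0.1 + N * n.1, q0.2 + N * n.2).
have dist q : dot (q - c) (q - c) =
   dot (q - q0) (q - q0) - 2 * N * dot n (q - q0) + N ^+ 2 * dot n n.
  by rewrite /dot /c /=; ring.
have [p /set_mem Kp pmax] := compact_EVT_max (ex_intro _ _ Kq0)
  (compact_in_box _ _ clK KM) (continuous_subspaceT (@continuous_dist2 R c)).
have pq0 := pmax q0 (mem_set Kq0).
have cq0 : dot (q0 - c) (q0 - c) = N ^+ 2 * dot n n.
  by rewrite dist subrr /dot /= !mulr0 addr0 mulr0 subr0 add0r.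
have [Sp Tp STp nOp] := Kp.
(* The two extended sides lie in Omega, so p is on neither of them; the choice of N keeps it off the
   third side. *)
have {Sp}Sp : 0 < S p.
  rewrite lt0r Sp andbT; apply/eqP => Sp0; apply: nOp.
  have := sz (T p) Tp; rewrite Sp0 add0r in STp; move=> /(_ STp).
  rewrite (_ : _ + _ = p) // [RHS]STE Sp0.
  by congr pair; rewrite /= /GRing.scale /=; ring.
have {Tp}Tp : 0 < T p.
  rewrite lt0r Tp andbT; apply/eqP => Tp0; apply: nOp.
  have := sx (S p) (ltW Sp); rewrite Tp0 addr0 in STp; move=> /(_ STp).
  rewrite (_ : _ + _ = p) // [RHS]STE Tp0.
  by congr pair; rewrite /= /GRing.scale /=; ring.
have {STp}STp : S p + T p < 1 + d.
  rewrite lt_neqAle STp andbT; apply/eqP => STd.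
  have npd : dot n (p - q0) = d by have := STn p; rewrite STd => /addrI.
  move: pq0; rewrite cq0 dist npd => pq0.
  have ND : 2 * N * d = 8 * M ^+ 2 + 1 by rewrite /N; field; rewrite gt_eqF.
  have [p1 p2] := KM p Kp; have [q1 q2] := KM q0 Kq0.
  have sq (r s : R) : `|r| <= M -> `|s| <= M -> (r - s) * (r - s) <= 4 * M ^+ 2.
    by rewrite !ler_norml => /andP[? ?] /andP[? ?]; nra.
  have : dot (p - q0) (p - q0) <= 8 * M ^+ 2.
    rewrite /dot; have := sq _ _ p1 q1; have := sq _ _ p2 q2.
    rewrite /=; move: (_ * _) (_ * _) (M ^+ 2); clear; move=> ? ? ?; lra.
  move: pq0 ND; move: (dot _ _) (2 * N * d) (M ^+ 2) (N ^+ 2 * _); clear.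
  by move=> ? ? ? ?; lra.
have np : nbhs p [set q | [/\ 0 < S q, 0 < T q & S q + T q < 1 + d]].
  have n1 : nbhs p [set q | 0 < S q] by exact: (cS p _ (lt_nbhsr Sp)).
  have n2 : nbhs p [set q | 0 < T q] by exact: (cT p _ (lt_nbhsr Tp)).
  have n3 : nbhs p [set q | S q + T q < 1 + d] by exact: (cST p _ (lt_nbhsl STp)).
  by apply: filterS3 n1 n2 n3.
have [e e0 He] := nbhs_square _ _ np.
exists p, c, e; split=> //.
  by apply: lt_le_trans pq0; rewrite cq0 mulr_gt0 // exprn_gt0.
move=> q qp pq; apply: contrapT => nOq.
have sq (r s : R) : r * r + s * s < e ^+ 2 -> `|r| < e /\ `|s| < e.
  move=> rs; have := sqr_ge0 r; have := sqr_ge0 s => r2 s2.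
  rewrite !ltr_norml; split; apply/andP; split; nra.
have [h1 h2] := sq _ _ qp.
have := He q.1 q.2 h1 h2; rewrite -surjective_pairing => -[S0 T0 ST0].
(* A point near p stays in the enlarged triangle; outside Omega it would belong to K and be farther
   from c than p. *)
have /mem_set/pmax : K q by split=> //; exact: ltW.
by rewrite leNgt pq.
Qed.

End ConcavePoint.

(** * C^k functions along the boundary *)

Section CkInterval.
Context {R : realType}.
Implicit Types (f g : R -> R) (k : nat) (a b : R).

(** Peeling off the first derivative, rather than the last, gives the form suited to induction on
    k. *)
Lemma Ck_itvS k a b f : Ck_itv k.+1 a b f <->
  (forall x, x \in `]a, b[ -> derivable f x 1 /\ {for x, continuous f}) /\
  Ck_itv k a b (derive1 f).
Proof.
split=> [H|[H1 H2] x xab].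
  split=> x /H[H1 H2]; first by split; [exact: (H1 0%N)|exact: (H2 0%N)].
  by split=> j jk; rewrite -derive1Sn; [exact: H1|exact: H2].
have [df cf] := H1 x xab; have [H3 H4] := H2 x xab.
split=> -[|j] jk; [exact: df| |exact: cf|]; rewrite derive1Sn.
  exact: H3.
exact: H4.
Qed.

Lemma Ck_itvW k a b f : Ck_itv k.+1 a b f -> Ck_itv k a b f.
Proof.
move=> H x /H[H1 H2]; split=> j jk; first exact/H1/ltnW.
exact/H2/leqW.
Qed.

(** The rules of differentiation identify derivatives only on the interval, so the inductions below
    must replace a function by one that agrees with it there. *)
Lemma Ck_itv_ext k a b f g : {in `]a, b[, f =1 g} ->
  Ck_itv k a b f -> Ck_itv k a b g.
Proof.
elim: k f g => [|k IHk] f g fg.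
  move=> H x xab; split=> // -[|//] _ /=; have [_ /(_ 0%N isT) /= cf] := H x xab.
  have nfg : \forall y \near x, f y = g y.
    near=> y; apply: fg; near: y; exact: near_in_itvoo.
  rewrite /prop_for /continuous_at -(fg x xab).
  by apply: cvg_trans cf; apply: near_eq_cvg.
move=> /Ck_itvS[H1 H2]; apply/Ck_itvS.
have nfg x : x \in `]a, b[ -> \forall y \near x, f y = g y.
  by move=> xab; near=> y; apply: fg; near: y; exact: near_in_itvoo.
split; last first.
  apply: IHk H2 => x xab; rewrite !derive1E; apply: near_eq_derive; exact: nfg.
move=> x xab; have [df cf] := H1 x xab; split.
  exact: near_eq_derivable (nfg x xab) df.
rewrite /prop_for /continuous_at -(fg x xab).
by apply: cvg_trans cf; apply: near_eq_cvg; exact: nfg.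
Unshelve. all: by end_near. Qed.

Lemma Ck_itv_cst k a b (r : R) : Ck_itv k a b (fun=> r).
Proof.
elim: k r => [|k IHk] r.
  by move=> x _; split=> // -[|//] _; exact: cvg_cst.
apply/Ck_itvS; split.
  by move=> x _; split; [exact: derivable_cst|exact: cvg_cst].
by apply: Ck_itv_ext (IHk 0) => x _; rewrite derive1_cst.
Qed.

Lemma Ck_itv_id k a b : Ck_itv k a b id.
Proof.
case: k => [|k]; first by move=> x _; split=> // -[|//] _; exact: cvg_id.
apply/Ck_itvS; split.
  by move=> x _; split; [exact: derivable_id|exact: cvg_id].
by apply: Ck_itv_ext (Ck_itv_cst k a b 1) => x _; rewrite derive1_id.
Qed.

Lemma Ck_itvD k a b f g : Ck_itv k a b f -> Ck_itv k a b g ->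
  Ck_itv k a b (fun x => f x + g x).
Proof.
elim: k f g => [|k IHk] f g.
  move=> Hf Hg x xab; split=> // -[|//] _.
  by apply: cvgD; [exact: (Hf x xab).2 0%N isT|exact: (Hg x xab).2 0%N isT].
move=> /Ck_itvS[f1 f2] /Ck_itvS[g1 g2]; apply/Ck_itvS; split.
  move=> x xab; have [df cf] := f1 x xab; have [dg cg] := g1 x xab.
  by split; [exact: derivableD|exact: cvgD].
apply: Ck_itv_ext (IHk _ _ f2 g2) => x xab.
have [df cf] := f1 x xab; have [dg cg] := g1 x xab.
by rewrite !derive1E -(deriveD df dg).
Qed.

Lemma Ck_itvM k a b f g : Ck_itv k a b f -> Ck_itv k a b g ->
  Ck_itv k a b (fun x => f x * g x).
Proof.
elim: k f g => [|k IHk] f g.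
  move=> Hf Hg x xab; split=> // -[|//] _.
  by apply: cvgM; [exact: (Hf x xab).2 0%N isT|exact: (Hg x xab).2 0%N isT].
move=> Hf Hg; have /Ck_itvS[f1 f2] := Hf; have /Ck_itvS[g1 g2] := Hg.
apply/Ck_itvS; split.
  move=> x xab; have [df cf] := f1 x xab; have [dg cg] := g1 x xab.
  by split; [exact: derivableM|exact: cvgM].
have := Ck_itvD _ _ _ _ _ (IHk _ _ (Ck_itvW _ _ _ _ Hf) g2)
  (IHk _ _ (Ck_itvW _ _ _ _ Hg) f2).
apply: Ck_itv_ext => x xab.
have [df cf] := f1 x xab; have [dg cg] := g1 x xab.
by rewrite !derive1E; exact: esym (deriveM df dg).
Qed.

(** In a graph parametrization the function is a polynomial in the parameter and f. *)
Lemma Ck_on_curve_dist2 k (G : set (R * R)) (p : R * R) (m n : R) :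
  Ck_on_curve k G (fun q => m + n * dot (q - p) (q - p)).
Proof.
move=> q _ o e1 e2 a b f _ Cf.
have cD := Ck_itvD k a b; have cM := Ck_itvM k a b; have cC := Ck_itv_cst k a b.
have C (r s t z : R) : Ck_itv k a b (fun x => r + x * s + f x * t - z) :=
  cD _ _ (cD _ _ (cD _ _ (cC r) (cM _ _ (Ck_itv_id k a b) (cC s)))
    (cM _ _ Cf (cC t))) (cC (- z)).
have C1 := C o.1 e1.1 e2.1 p.1; have C2 := C o.2 e1.2 e2.2 p.2.
exact: (cD _ _ (cC m) (cM _ _ (cC n) (cD _ _ (cM _ _ C1 C1) (cM _ _ C2 C2)))).
Qed.

End CkInterval.

(** * Non-existence of the extension *)

Section NonExistence.
Context {R : realType}.
Implicit Types (p q c : R * R) (u : R * R -> R) (Omega : set (R * R)).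

Lemma closure_in_box Omega : bounded_set Omega ->
  exists M : R, forall q, closure Omega q -> `|q.1| <= M /\ `|q.2| <= M.
Proof.
move=> [M [_ /(_ (M + 1))]]; rewrite ltrDl ltr01 => /(_ isT) HM.
exists (M + 1).
have cl : closed [set q : R * R | `|q.1| <= M + 1 /\ `|q.2| <= M + 1].
  have -> : [set q : R * R | `|q.1| <= M + 1 /\ `|q.2| <= M + 1] =
    (fun q : R * R => `|q.1|) @^-1` [set r | r <= M + 1] `&`
    (fun q : R * R => `|q.2|) @^-1` [set r | r <= M + 1] by [].
  apply: closedI; (apply: closed_comp; last exact: closed_le) => q _.
    by apply: cvg_norm; exact: cvg_fst.
  by apply: cvg_norm; exact: cvg_snd.
suff H : closure Omega `<=` [set q : R * R | `|q.1| <= M + 1 /\ `|q.2| <= M + 1].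
  by move=> q /H.
have /closure_id -> := cl; apply: closure_subset => q Oq.
by have /= := HM q Oq; rewrite prod_normE ge_max => /andP[].
Qed.

(** Makes 1 + tau^2 rho^2 itself an admissible value of A. *)
Lemma one_add_le_sqr (r : R) : 0 <= r -> 1 + r <= (1 + r) ^+ 2.
Proof. by move=> r0; rewrite expr2 ler_peMl; lra. Qed.

Lemma dist2_ray p c (s : R) :
  dot (p + s *: (p - c) - c) (p + s *: (p - c) - c) =
  (1 + s) ^+ 2 * dot (p - c) (p - c).
Proof. by rewrite /dot /= /GRing.scale /=; ring. Qed.

Lemma nbhs_disc p (e : R) : 0 < e -> nbhs p (disc p e).
Proof.
move=> e0; have pe : dot (p - p) (p - p) < e ^+ 2.
  by rewrite subrr /dot /= !mul0r addr0 exprn_gt0.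
exact: (continuous_dist2 p p _ (lt_nbhsl pe)).
Qed.

(** Moving from p slightly away from c leads into Omega. *)
Lemma concave_point_boundary Omega p c (e : R) : ~ Omega p -> 0 < e ->
  0 < dot (p - c) (p - c) ->
  (forall q, dot (q - p) (q - p) < e ^+ 2 ->
     dot (p - c) (p - c) < dot (q - c) (q - c) -> Omega q) ->
  boundary Omega p.
Proof.
move=> nOp e0 pc0 He; split; last by move=> /nbhs_singleton.
move=> B nB.
have [d d0 H] := line_near _ _ (p - c) (filterI nB (nbhs_disc p _ e0)).
have d20 : 0 < d / 2 by rewrite divr_gt0.
have [] := H (d / 2); first by rewrite gtr0_norm // ltr_pdivrMr // ltr_pMr // ltr1n.
move=> Bq eq; exists (p + (d / 2) *: (p - c)); split => //; apply: He => //.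
by rewrite dist2_ray ltr_pMl // expr_gt1 //; lra.
Qed.

(** Comparison with the barrier around the disc of centre p, on the closure of Omega minus that
    disc: the maximum sits outside Omega, thus on its boundary, where u <= 0. *)
Lemma bound_off_disc Omega u (tau M : R) p (e A : R) :
  open Omega -> (forall q, closure Omega q -> `|q.1| <= M /\ `|q.2| <= M) ->
  {within closure Omega, continuous u} -> Ck_on 2 Omega u ->
  (forall q, Omega q -> minimal_surface_eq tau u q) ->
  closure Omega p -> 0 < e -> 0 < A -> 1 + tau ^+ 2 * e ^+ 2 <= A ^+ 2 ->
  (forall q, boundary Omega q -> e ^+ 2 <= dot (q - p) (q - p) -> u q <= 0) ->
  forall x, closure Omega x -> e ^+ 2 <= dot (x - p) (x - p) ->
    u x <= 4 * A * M + 4 * `|tau| * M ^+ 2.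
Proof.
move=> oO HM cu Cu mse clp e0 A0 hA ub x clx xp.
pose S := [set q | closure Omega q /\ e ^+ 2 <= dot (q - p) (q - p)].
have cS : compact S.
  apply: (compact_in_box _ M); last by move=> q [/HM].
  apply: closedI; first exact: closed_closure.
  apply: (@closed_comp _ _ (fun q => dot (q - p) (q - p)) [set r | e ^+ 2 <= r]).
    by move=> q _; exact: continuous_dist2.
  exact: closed_ge.
have cuS : {within S, continuous u} by apply: continuous_subspaceW cu => q [].
have [q [[clq qp] nOq] xq] : exists2 q, S q /\ ~ Omega q &
    u x - barrier tau A p e x <= u q - barrier tau A p e q.
  apply: (barrier_comparison Omega u tau A p e S (~` Omega)) => //.
    by move=> q [].
  move=> q Sq /contrapT Oq; split=> //.
  have := open_nbhs_nbhs (conj oO Oq); apply: filterS => y Oy yp.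
  by split=> //; exact: subset_closure.
have uq : u q <= 0 by apply: ub => //; split=> // /nbhs_singleton.
have [p1 p2] := HM p clp; have [x1 x2] := HM x clx; have [q1 q2] := HM q clq.
have := barrier_oscillation tau A M p e x q A0 p1 p2 x1 x2 q1 q2.
move: (barrier tau A p e x) (barrier tau A p e q) (4 * A * M + _) (u x) (u q) xq uq.
by clear => *; lra.
Qed.

(** Comparison on the part of the closed disc around p outside the disc around c. This region lies
    in Omega, and the maximum is attained at distance e from p, where u <= C. *)
Lemma bound_outside_disc Omega u (tau M C : R) p c (e rho A : R) :
  open Omega -> (forall q, Omega q -> `|q.1| <= M /\ `|q.2| <= M) ->
  `|c.1| <= M -> `|c.2| <= M ->
  {within closure Omega, continuous u} -> Ck_on 2 Omega u ->
  (forall q, Omega q -> minimal_surface_eq tau u q) ->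
  0 < rho -> 0 < A -> 1 + tau ^+ 2 * rho ^+ 2 <= A ^+ 2 ->
  (forall q, dot (q - p) (q - p) <= e ^+ 2 ->
     rho ^+ 2 <= dot (q - c) (q - c) -> Omega q) ->
  (forall q, Omega q -> e ^+ 2 <= dot (q - p) (q - p) -> u q <= C) ->
  forall x, dot (x - p) (x - p) <= e ^+ 2 -> rho ^+ 2 <= dot (x - c) (x - c) ->
    u x <= C + (4 * A * M + 4 * `|tau| * M ^+ 2).
Proof.
move=> oO HM c1 c2 cu Cu mse r0 A0 hA SO ub x xp xc.
pose S := [set q | dot (q - p) (q - p) <= e ^+ 2 /\ rho ^+ 2 <= dot (q - c) (q - c)].
have {}SO q : S q -> Omega q by move=> [? ?]; exact: SO.
have cS : compact S.
  apply: (compact_in_box _ M); last by move=> q /SO/HM.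
  apply: closedI.
    apply: (@closed_comp _ _ (fun q => dot (q - p) (q - p)) [set r | r <= e ^+ 2]).
      by move=> q _; exact: continuous_dist2.
    exact: closed_le.
  apply: (@closed_comp _ _ (fun q => dot (q - c) (q - c)) [set r | rho ^+ 2 <= r]).
    by move=> q _; exact: continuous_dist2.
  exact: closed_ge.
have cuS : {within S, continuous u}.
  by apply: continuous_subspaceW cu => q /SO Oq; exact: subset_closure.
have [q [Sq qe] xq] : exists2 q, S q /\ e ^+ 2 <= dot (q - p) (q - p) &
    u x - barrier tau A c rho x <= u q - barrier tau A c rho q.
  apply: (barrier_comparison Omega u tau A c rho S
    [set q | e ^+ 2 <= dot (q - p) (q - p)]) => //.
    by move=> q [].
  move=> q Sq /negP; rewrite -ltNge => qe; split; first exact: SO.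
  have : nbhs q [set y | dot (y - p) (y - p) < e ^+ 2].
    exact: (continuous_dist2 p q _ (lt_nbhsl qe)).
  by apply: filterS => y /ltW ye yc; split.
have uq := ub q (SO q Sq) qe.
have [x1 x2] := HM x (SO x (conj xp xc)); have [q1 q2] := HM q (SO q Sq).
have := barrier_oscillation tau A M c rho x q A0 c1 c2 x1 x2 q1 q2.
move: (barrier tau A c rho x) (barrier tau A c rho q) (4 * A * M + _) (u x) (u q) xq uq.
by clear => *; lra.
Qed.

End NonExistence.

Theorem theorem3p1 (R : realType) (tau : R) (k : nat) (Omega : set (R * R))
  (tau_neq0 : tau != 0)
  (Omega_domain : domain Omega)
  (Omega_bounded : bounded_set Omega)
  (Gamma_jordan : jordan_curve (boundary Omega))
  (Gamma_Ck : Ck_curve k (boundary Omega))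
  (Gamma_nonconvex : ~ convex_boundary Omega) :
  exists phi : R * R -> R,
    Ck_on_curve k (boundary Omega) phi /\
    ~ (exists u : R * R -> R, minimal_extension tau Omega phi u).
Proof.
have [_ oO cO] := Omega_domain.
have [x [y [z [yx yz nxz]]]] :=
  broken_segment _ oO cO (nonconvex_segment _ oO Gamma_nonconvex).
have [p [c [e [nOp e0 pc0 He]]]] := concave_point _ _ _ _ oO yx yz nxz.
have bp := concave_point_boundary _ _ _ _ nOp e0 pc0 He.
have [M0 HM0] := closure_in_box _ Omega_bounded.
pose M := Num.max M0 (Num.max `|c.1| `|c.2|).
have HM q : closure Omega q -> `|q.1| <= M /\ `|q.2| <= M.
  by move=> /HM0[q1 q2]; rewrite !le_max q1 q2.
have c1 : `|c.1| <= M by rewrite !le_max lexx !orbT.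
have c2 : `|c.2| <= M by rewrite !le_max lexx !orbT.
(* Halving e places the closed disc of radius [e'] inside the open disc of [He]. *)
pose e' := e / 2.
have e'0 : 0 < e' by rewrite divr_gt0.
have e'e : e' ^+ 2 < e ^+ 2.
  by rewrite ltr_pXn2r ?nnegrE ?ltW // ltr_pdivrMr // ltr_pMr // ltr1n.
pose A := 1 + tau ^+ 2 * e' ^+ 2.
have tA : 0 <= tau ^+ 2 * e' ^+ 2 by rewrite mulr_ge0 ?sqr_ge0.
have A0 : 0 < A by rewrite ltr_pwDl.
(* One constant for all the discs of centre c used below, whose radii are at most twice the distance
   from p to c. *)
pose B := 1 + tau ^+ 2 * (4 * dot (p - c) (p - c)).
have tB : 0 <= tau ^+ 2 * (4 * dot (p - c) (p - c)).
  by rewrite mulr_ge0 ?sqr_ge0 // mulr_ge0 // ltW.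
have B0 : 0 < B by rewrite ltr_pwDl.
pose C := 4 * A * M + 4 * `|tau| * M ^+ 2.
pose C' := C + (4 * B * M + 4 * `|tau| * M ^+ 2).
pose N := C' + 1.
have M_ge0 : 0 <= M by apply: le_trans c1.
have N0 : 0 <= N.
  by rewrite !addr_ge0 ?mulr_ge0 ?sqr_ge0 // ltW.
(* This function is N at p and nonpositive at distance at least [e'] from p. Neither C nor [C']
   depends on it. *)
exists (fun q => N + (- (N / e' ^+ 2)) * dot (q - p) (q - p)).
split; first exact: Ck_on_curve_dist2.
move=> [u [cu su mse bu]].
have Cu := su 2%N.
have offp : forall q, closure Omega q -> e' ^+ 2 <= dot (q - p) (q - p) -> u q <= C.
  apply: (bound_off_disc Omega) => //; first by case: bp.
    exact: one_add_le_sqr.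
  move=> q bq eq; rewrite (bu q bq) mulNr subr_le0 mulrAC ler_pdivlMr ?exprn_gt0 //.
  exact: ler_wpM2l.
have near_bound (s : R) : 0 < s -> s <= 1 ->
    dot (p + s *: (p - c) - p) (p + s *: (p - c) - p) <= e' ^+ 2 ->
    u (p + s *: (p - c)) <= C'.
  move=> s0 s1 spe.
  (* The point to be bounded lies on the rim of this slightly enlarged disc. *)
  pose rho := (1 + s) * Num.sqrt (dot (p - c) (p - c)).
  have rho2 : rho ^+ 2 = (1 + s) ^+ 2 * dot (p - c) (p - c).
    by rewrite exprMn sqr_sqrtr // ltW.
  have rho0 : 0 < rho by rewrite mulr_gt0 ?sqrtr_gt0 // addr_gt0.
  apply: (bound_outside_disc Omega u tau M C p c e' rho B) => //.
  - by move=> q Oq; apply: HM; exact: subset_closure.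
  - apply: le_trans (one_add_le_sqr _ tB); rewrite lerD2l.
    apply: ler_wpM2l; first exact: sqr_ge0.
    by rewrite rho2; apply: ler_wpM2r; [exact: ltW|nra].
  - move=> q qp qc; apply: He; first exact: le_lt_trans e'e.
    by apply: lt_le_trans qc; rewrite rho2 ltr_pMl // expr_gt1 //; lra.
  - by move=> q Oq; apply: offp; exact: subset_closure.
  - by rewrite dist2_ray rho2.
have up : u p = N.
  by rewrite (bu p bp) subrr /dot /= !mul0r addr0 mulr0 addr0.
(* By continuity at p, u is within 1 of N = C' + 1 near p, hence above [C'] on the ray, against
   [near_bound]. *)
have /subspace_continuousP/(_ p bp.1)/cvgrPdist_lt/(_ 1 ltr01) := cu.
rewrite near_withinE => nu.
have [d d0 H] := line_near _ _ (p - c) (filterI nu (nbhs_disc p _ e'0)).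
pose s := Num.min d 1 / 2.
have m0 : 0 < Num.min d 1 by rewrite lt_min d0 ltr01.
have s0 : 0 < s by rewrite divr_gt0.
have : s < Num.min d 1 by rewrite ltr_pdivrMr // ltr_pMr // ltr1n.
rewrite lt_min => /andP[sd s1].
have [] := H s; first by rewrite gtr0_norm.
move=> us sp; have := near_bound s s0 (ltW s1) (ltW sp).
have Os : Omega (p + s *: (p - c)).
  apply: He; first exact: lt_trans e'e.
  by rewrite dist2_ray ltr_pMl // expr_gt1 //; lra.
have : `|u p - u (p + s *: (p - c))| < 1 by exact: us (subset_closure Os).
rewrite up /N ltr_norml.
by move: (u _) (C'); clear => ? ?; lra.
Qed.
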